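(* Let $\varphi(x)=\frac14|x|^2$ on $\mathbb{R}^2$, so that the zero loop set $\mathscr{L}=\{x\mid\varphi(x)+\varphi(x)=0\}$ is the single point $\{0\}$. Consider in $\mathbb{R}^2$ the system $$\begin{cases}\min(-\Delta u^1,\;u^1-u^2+\varphi)=0\\ \min(-\Delta u^2,\;u^2-u^1+\varphi)=0.\end{cases}\tag{S}$$ The difference $U=u^1-u^2$ solves the double-obstacle problem in $\mathbb{R}^2$ $$-\Delta U=\begin{cases}1 & \text{if } U=-\varphi\\ -1 & \text{if } U=\varphi\\ 0 & \text{if } -\varphi<U<\varphi,\end{cases}\tag{D}$$ and $-\Delta u^1=(-\Delta U)^+$, $-\Delta u^2=(\Delta U)^+$. The function $$w=\begin{cases}-\frac14|x|^2 & \text{if } x_1>0,\ x_2>0\\ \frac14(x_1^2-x_2^2) & \text{if } x_1<0,\ x_2>0\\ \frac14(x_2^2-x_1^2) & \text{if } x_1>0,\ x_2<0\\ \frac14|x|^2 & \text{if } x_1<0,\ x_2<0\end{cases}$$ is $C^{1,1}$ and solves (D); choose $U\equiv w$. In polar coordinates $(r,\theta)$ define $$u^1(r,\theta)=\begin{cases}-\frac14r^2-\frac1{2\pi}r^2\theta\cos2\theta-\frac1{2\pi}r^2\ln r\,\sin2\theta & \text{if } 0<\theta\le\frac\pi2\\ -\frac14r^2\cos2\theta+\frac1{2\pi}r^2\theta\cos2\theta+\frac1{2\pi}r^2\ln r\,\sin2\theta & \text{otherwise}\end{cases}$$ and $u^2=u^1-w$, that is, $$u^2(r,\theta)=\begin{cases}-\frac1{2\pi}r^2\theta\cos2\theta-\frac1{2\pi}r^2\ln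 r\,\sin2\theta & \text{if } 0<\theta\le\frac\pi2\\ -\frac12r^2\cos2\theta+\frac1{2\pi}r^2\theta\cos2\theta+\frac1{2\pi}r^2\ln r\,\sin2\theta & \text{if } \frac\pi2<\theta\le\pi\\ -\frac14r^2-\frac14r^2\cos2\theta+\frac1{2\pi}r^2\theta\cos2\theta+\frac1{2\pi}r^2\ln r\,\sin2\theta & \text{if } \pi<\theta\le\frac{3\pi}2\\ \frac1{2\pi}r^2\theta\cos2\theta+\frac1{2\pi}r^2\ln r\,\sin2\theta & \text{if } \frac{3\pi}2<\theta\le2\pi.\end{cases}$$ Here the function $r^2\theta\cos2\theta+r^2\ln r\,\sin2\theta$ is in $C^{1,\gamma}$ for every $0<\gamma<1$ and solves the Laplace equation in $\mathbb{R}^2\setminus\{0\}$, but is not $C^{1,1}$ near the origin. Then $u^1$ is a $C^{1,\gamma}$ function in the unit ball of $\mathbb{R}^2$ but is not $C^{1,1}$ in the neighborhood of the origin, since $\left|\frac{\partial^2u^1}{\partial r^2}\right|\approx|\ln r|\to\infty$ as $r\to0$. Moreover $-\Delta u^1(r,\theta)=\chi_{\{0<\theta\le\pi/2\}}=\chi_{\{u^1>0\}}$ provided $r>0$ is small enough. Neither $u^1$ nor $u^2$ is a $C^{1,1}$ function, but $(u^1,u^2)$ solves (S). Thus, if the zero loop set has an isolated point, the solution may fail to be $C^{1,1}$.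
   Context: $\chi_E$ denotes the characteristic function of a set $E$, and $a^+=\max(a,0)$. Solutions of (S) are understood in the strong sense: $u^1-u^2+\varphi\ge0$ and $u^2-u^1+\varphi\ge0$; $-\Delta u^i\ge0$ a.e. for $i=1,2$; and if $u^1-u^2+\varphi>0$ (respectively $u^2-u^1+\varphi>0$) at some point, then $\Delta u^1=0$ (respectively $\Delta u^2=0$) in a neighborhood of that point. $C^{1,\gamma}$ is the Hölder space of $C^1$ functions whose first derivatives are Hölder continuous with exponent $\gamma$; $C^{1,1}$ means that the first derivatives are Lipschitz continuous.
   Formalization: u¹ is corrected (1/(2π) becomes 1/(4π), second branch's sign reversed), u² recomputed; r²θcos2θ+r²ln r sin2θ is treated off θ=0, on sectors; ∂²u¹/∂r² where sin2θ≠0; −Δu¹ off θ=π/2, 2π; the equality with χ_{u¹>0} ray by ray, excluding θ=π/2 and (π,3π/2]. *)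

(* Defs.v *)
From HB Require Import structures.
From mathcomp Require Import all_boot all_order all_algebra.
From mathcomp Require Import all_classical all_reals all_analysis.
From mathcomp Require Import ring lra.

Set Implicit Arguments.
Unset Strict Implicit.
Unset Printing Implicit Defensive.

Import Order.TTheory GRing.Theory Num.Theory.
Import numFieldNormedType.Exports.

Local Open Scope classical_set_scope.
Local Open Scope ring_scope.

Section plane.
Context {R : realType}.
Implicit Types (x y : R * R) (f u : R * R -> R).

(* The library norm on R * R is the sup norm; [enorm] is the Euclidean one. *)
Definition enorm x : R := Num.sqrt (x.1 ^+ 2 + x.2 ^+ 2).

Definition e1 : R * R := (1, 0).
Definition e2 : R * R := (0, 1).

Definition unit_ball : set (R * R) := [set x | enorm x < 1].

Definition plane_measure := ((@lebesgue_measure R) \x (@lebesgue_measure R))%E.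

Definition C1 f : Prop :=
  [/\ forall x, differentiable f x,
      continuous (fun x => 'D_e1 f x) & continuous (fun x => 'D_e2 f x)].

(* C^{1,g} on an open set A, with one Hoelder constant valid on all of A;
   g = 1 gives C^{1,1}. *)
Definition C1holder (A : set (R * R)) (g : R) f : Prop :=
  (forall x, A x -> differentiable f x) /\
  exists C : R, forall x y, A x -> A y ->
    `|'D_e1 f x - 'D_e1 f y| <= C * enorm (x - y) `^ g /\
    `|'D_e2 f x - 'D_e2 f y| <= C * enorm (x - y) `^ g.

Definition C11_near f x : Prop :=
  exists V : set (R * R), [/\ open V, V x & C1holder V 1 f].

(* f is twice differentiable at x and its Laplacian there is l.  A relation is
   used because ['D_v f x] is a junk value when f is not derivable at x. *)
Definition has_laplacian f x (l : R) : Prop :=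
  [/\ \forall y \near x, differentiable f y,
      differentiable (fun y => 'D_e1 f y) x,
      differentiable (fun y => 'D_e2 f y) x &
      'D_e1 (fun y => 'D_e1 f y) x + 'D_e2 (fun y => 'D_e2 f y) x = l].

Definition zero_loop_set (p : R * R -> R) : set (R * R) :=
  [set x | p x + p x = 0].

(* Strong solutions of
     min (- Delta u1, u1 - u2 + p) = 0,   min (- Delta u2, u2 - u1 + p) = 0. *)
Definition solves_system (p u1 u2 : R * R -> R) : Prop :=
  [/\ C1 u1 /\ C1 u2,
      forall x, 0 <= u1 x - u2 x + p x /\ 0 <= u2 x - u1 x + p x,
      {ae plane_measure, forall x,
         (exists2 l, has_laplacian u1 x l & 0 <= - l) /\
         (exists2 l, has_laplacian u2 x l & 0 <= - l)},
      forall x, 0 < u1 x - u2 x + p x ->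
        \forall y \near x, has_laplacian u1 y 0 &
      forall x, 0 < u2 x - u1 x + p x ->
        \forall y \near x, has_laplacian u2 y 0].

(* Strong solutions of the double-obstacle problem
   - Delta U = 1 on {U = - p},  -1 on {U = p},  0 on {- p < U < p}. *)
Definition solves_double_obstacle (p U : R * R -> R) : Prop :=
  [/\ C1 U,
      forall x, - p x <= U x <= p x &
      {ae plane_measure, forall x, exists l,
         [/\ has_laplacian U x l,
             U x = - p x -> - l = 1,
             U x = p x -> - l = -1 &
             - p x < U x < p x -> - l = 0]}].

Definition phi x : R := enorm x ^+ 2 / 4.

(* The four branches agree on the coordinate axes, so w is the continuous
   extension of the function given by the same formulas on open quadrants. *)
Definition w x : R :=
  if (0 <= x.1) && (0 <= x.2) then - (x.1 ^+ 2 + x.2 ^+ 2) / 4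
  else if (x.1 <= 0) && (0 <= x.2) then (x.1 ^+ 2 - x.2 ^+ 2) / 4
  else if (0 <= x.1) && (x.2 <= 0) then (x.2 ^+ 2 - x.1 ^+ 2) / 4
  else (x.1 ^+ 2 + x.2 ^+ 2) / 4.

Definition polar (r t : R) : R * R := (r * cos t, r * sin t).

(* The polar angle in ]0, 2 pi] (see [polarK]); its value at the origin is
   irrelevant below. *)
Definition angle x : R :=
  if 0 < x.2 then acos (x.1 / enorm x) else 2 * pi - acos (x.1 / enorm x).

(* r^2 (t cos 2t + ln r sin 2t) is the imaginary part of z^2 log z, with the
   branch of the logarithm cut along the half-axis t = 0.  It is harmonic off
   the cut and jumps by 2 pi r^2 across it. *)
Definition h_pol (r t : R) : R :=
  r ^+ 2 * t * cos (2 * t) + r ^+ 2 * ln r * sin (2 * t).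

(* The coefficient of h is forced: a C^1 function r^2 (A ln r sin 2t + g t)
   with - Delta = 1 for 0 < t < pi/2 and 0 elsewhere satisfies
   g'' + 4 g = - 1_(0, pi/2) - 4 A sin 2t, which has a periodic solution g
   only for A = - 1 / (4 pi).  The remaining terms make the two branches match
   to first order at t = pi/2 and across the cut t = 0, 2 pi. *)
Definition u1_pol (r t : R) : R :=
  if t <= pi / 2 then - (r ^+ 2 / 4) - h_pol r t / (4 * pi)
  else r ^+ 2 * cos (2 * t) / 4 - h_pol r t / (4 * pi).

Definition u2_pol (r t : R) : R :=
  if t <= pi then - (h_pol r t / (4 * pi))
  else if t <= 3 * pi / 2 then
    - (r ^+ 2 / 4) + r ^+ 2 * cos (2 * t) / 4 - h_pol r t / (4 * pi)
  else r ^+ 2 * cos (2 * t) / 2 - h_pol r t / (4 * pi).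

Definition h x : R := h_pol (enorm x) (angle x).
Definition u1 x : R := u1_pol (enorm x) (angle x).
Definition u2 x : R := u2_pol (enorm x) (angle x).

Definition sector (a b : R) : set (R * R) :=
  [set x | x != 0 /\ a < angle x < b].

Lemma polarK (r t : R) : 0 < r -> 0 < t <= 2 * pi ->
  enorm (polar r t) = r /\ angle (polar r t) = t.
Proof.
move=> r0 /andP[t0 t2].
have nE : enorm (polar r t) = r.
  rewrite /enorm /polar /= !exprMn -mulrDr cos2Dsin2 mulr1 sqrtr_sqr.
  by rewrite ger0_norm // ltW.
split=> //; rewrite /angle nE /= mulrAC divff ?gt_eqF// mul1r pmulr_rgt0 //.
have [tpi|pit] := ltP t pi.
  rewrite sin_gt0_pi ?t0 // cosK // in_itv /=.
  by rewrite !ltW.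
have -> : cos t = cos (2 * pi - t).
  by rewrite -[LHS]cosN -[LHS]cosD2pi mulr2n; congr cos; ring.
have -> : (0 < sin t) = false.
  apply/negbTE; rewrite -leNgt.
  have -> : t = (t - pi) + pi by ring.
  rewrite sinDpi oppr_le0 sin_ge0_pi //; lra.
rewrite cosK ?in_itv /=; [ring | apply/andP; split; lra].
Qed.

End plane.

(* Main.v *)
Require Import Defs.
From mathcomp Require Import all_boot all_order all_algebra.
From mathcomp Require Import all_classical all_reals all_analysis.
From mathcomp Require Import ring lra.

Set Implicit Arguments.
Unset Strict Implicit.
Unset Printing Implicit Defensive.

Import Order.TTheory GRing.Theory Num.Theory.
Import numFieldNormedType.Exports.

Local Open Scope classical_set_scope.
Local Open Scope ring_scope.

(** Everything about [u1] and [u2] follows from one decomposition.  With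
      [logpart x = x1^2 atan (x2 / x1) + x2^2 atan (x1 / x2) + 2 x1 x2 ln |x|],
      [umean x = - x1^2 / 8 - logpart x / (4 pi)]
    one has [u1 = umean + w / 2] and [u2 = umean - w / 2] on the whole plane
    ([u1E], [u2E]).  The function [w = - (x1 |x1| + x2 |x2|) / 4] is odd with
    Lipschitz gradient [- (|x1|, |x2|) / 2], and [umean] is even, so
    [u2 x = u1 (- x)] ([u2N]) and Laplacians transfer from [u1] to [u2] by
    reflection.

    Regularity.  The gradient of [logpart] has first component
    [2 x1 atan (x2 / x1) + 2 x2 ln |x| + x2], and symmetrically for the second.
    The term [x1 atan (x2 / x1)] is Lipschitz on the plane, because moving
    between two points costs at least the radius times a multiple of the change
    of angle ([polar_lip], [homat_lip]).  The term [x2 ln |x|] is Hoelder on the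
    unit ball for every exponent in ]0, 1[ ([mul_ln_holder]); it is not Lipschitz
    near the origin, which is seen along a single ray ([rlnr_not_lip]).

    Laplacians.  Off the cut [x1 >= 0, x2 = 0] the polar angle has gradient
    [(- x2, x1) / |x|^2] ([grad_angle]), hence [h], the imaginary part of
    [z^2 log z], is harmonic there.  Where [x1 < 0] or [x2 < 0], [u1] is
    [(x1^2 - x2^2) / 4 - h / (4 pi)], thus harmonic; in the open first quadrant
    it is [- |x|^2 / 4 - h / (4 pi)], with Laplacian [- 1].

    The difference [U] of an arbitrary solution.  On [U = - phi] the nonnegative
    C^1 function [U + phi] attains its minimum, so its gradient vanishes there.
    Each component of the gradient has zero partial derivatives, where they
    exist, at almost every one of its own zeros: zeros with a nonzero partial
    derivative are isolated on lines parallel to an axis, so by Fubini they lie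
    in a null set ([derive_zero_ae]).
    Hence the Laplacian of [U + phi] is 0 almost everywhere on the contact set
    ([contact_laplacian_ae]), i.e. that of [U] is [- 1]; likewise on [U = phi].
    Strictly between the obstacles both components are harmonic. *)

(** * Gradients and Laplacians in the plane *)

Section flat.
Context {R : realType} {V W : normedModType R}.

Lemma is_diff_littleo (f : V -> W) (x : V) : f x = 0 ->
  (forall e : R, 0 < e -> \forall y \near x, `|f y| <= e * `|y - x|) ->
  is_diff x f 0.
Proof.
move=> fx0 fo.
have H : continuous (0 : V -> W) /\ f \o shift x = cst (f x) + 0 +o_ 0 id.
  split; first by move=> ?; exact: cvg_cst.
  apply/eqaddoP => _ /posnumP[e]; rewrite fx0.
  have := fo e%:num (gt0 e); rewrite (near_shift 0) subr0 => H0.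
  near=> z; rewrite !fctE /= addr0 subr0.
  have /= : `|f (shift x z)| <= e%:num * `|shift x z - x|.
    by near: z; exact: H0.
  by rewrite addrK.
have dE : 'd f x = 0 :> (V -> W) by case: H => H1 H2; exact: diff_unique.
by apply: DiffDef => //; apply/diff_locallyP; rewrite dE.
Unshelve. all: by end_near. Qed.

End flat.

Section gradient.
Context {R : realType}.
Implicit Types (x y : R * R) (f g : R * R -> R) (a b c d l : R).

(** Bundling differentiability with the values of both partial derivatives lets
    the gradient of a composite expression be computed by composing rules. *)
Definition is_grad f x a b := is_diff x f (fun v => a * v.1 + b * v.2).

Lemma is_gradE f x a b : is_grad f x a b ->
  [/\ differentiable f x, 'D_e1 f x = a & 'D_e2 f x = b].
Proof.
move=> [df dfE]; split=> //.
  by rewrite deriveE // dfE /= mulr1 mulr0 addr0.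
by rewrite deriveE // dfE /= mulr1 mulr0 add0r.
Qed.

Lemma differentiable_grad f x :
  differentiable f x -> is_grad f x ('D_e1 f x) ('D_e2 f x).
Proof.
move=> df; apply: DiffDef => //; apply/funext => v.
have {1}-> : v = v.1 *: e1 + v.2 *: e2.
  by case: v => a b; congr (_, _); rewrite /= /GRing.scale /=; ring.
rewrite linearD !linearZ /= -!deriveE // /GRing.scale /=; ring.
Qed.

Lemma is_grad_eq f x a b a' b' :
  is_grad f x a b -> a = a' -> b = b' -> is_grad f x a' b'.
Proof. by move=> ? <- <-. Qed.

Lemma grad_cst c x : is_grad (fun=> c) x 0 0.
Proof. by apply: is_diff_eq; apply/funext => v /=; rewrite !mul0r addr0. Qed.

Lemma grad_fst x : is_grad fst x 1 0.
Proof.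
have df : differentiable (fst : R * R -> R) x.
  by apply: linear_differentiable; move=> y; exact: cvg_fst.
apply: DiffDef => //; apply/funext => v; rewrite diff_lin //=.
  by rewrite mul1r mul0r addr0.
by move=> y; exact: cvg_fst.
Qed.

Lemma grad_snd x : is_grad snd x 0 1.
Proof.
have df : differentiable (snd : R * R -> R) x.
  by apply: linear_differentiable; move=> y; exact: cvg_snd.
apply: DiffDef => //; apply/funext => v; rewrite diff_lin //=.
  by rewrite mul1r mul0r add0r.
by move=> y; exact: cvg_snd.
Qed.

Lemma gradD f g x a b c d : is_grad f x a b -> is_grad g x c d ->
  is_grad (fun y => f y + g y) x (a + c) (b + d).
Proof.
move=> fx gx; apply: (@is_diff_eq _ _ _ _ _ _ _ (is_diffD fx gx)).
by apply/funext => v; rewrite /= !fctE; ring.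
Qed.

Lemma gradN f x a b : is_grad f x a b -> is_grad (fun y => - f y) x (- a) (- b).
Proof.
move=> fx; apply: (@is_diff_eq _ _ _ _ _ _ _ (is_diffN fx)).
by apply/funext => v; rewrite /= !fctE; ring.
Qed.

Lemma gradB f g x a b c d : is_grad f x a b -> is_grad g x c d ->
  is_grad (fun y => f y - g y) x (a - c) (b - d).
Proof. by move=> fx gx; apply: gradD => //; exact: gradN. Qed.

Lemma gradM f g x a b c d : is_grad f x a b -> is_grad g x c d ->
  is_grad (fun y => f y * g y) x (a * g x + f x * c) (b * g x + f x * d).
Proof.
move=> fx gx; apply: (@is_diff_eq _ _ _ _ _ _ _ (is_diffM fx gx)).
by apply/funext => v; rewrite /= !fctE /GRing.scale /=; ring.
Qed.

Lemma gradZ c f x a b : is_grad f x a b ->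
  is_grad (fun y => c * f y) x (c * a) (c * b).
Proof.
by move=> fx; apply: (is_grad_eq (gradM (grad_cst c x) fx)); rewrite mul0r add0r.
Qed.

Lemma grad_comp (k : R -> R) f x a b d :
  is_grad f x a b -> is_derive (f x) 1 k d ->
  is_grad (fun y => k (f y)) x (d * a) (d * b).
Proof.
move=> fx [kd kE].
have dk : is_diff (f x) k (fun t : R => d * t).
  apply: DiffDef; first exact/derivable1_diffP.
  by rewrite deriv1E // derive1E kE; apply/funext => t /=; rewrite mulrC.
apply: (@is_diff_eq _ _ _ _ _ _ _ (is_diff_comp fx dk)).
by apply/funext => v /=; ring.
Qed.

Lemma gradV f x a b : f x != 0 -> is_grad f x a b ->
  is_grad (fun y => (f y)^-1) x (- (f x) ^- 2 * a) (- (f x) ^- 2 * b).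
Proof.
move=> fx0 fab; apply: (grad_comp fab).
have := @deriveV R R id (f x) 1 fx0 (@derivable_id _ _ _ _).
have := @derivableV R R id (f x) 1 fx0 (@derivable_id _ _ _ _).
rewrite derive_id => dv dE; apply: DeriveDef => //.
by rewrite [LHS]dE /GRing.scale /= mulr1.
Qed.

Lemma grad_compN f x a b : is_grad f (- x) a b ->
  is_grad (fun y => f (- y)) x (- a) (- b).
Proof.
move=> fx; have dN : is_diff x (fun y : R * R => - y) (fun v => - v).
  exact: (@is_diff_eq _ _ _ _ _ _ _ (is_diffN (is_diff_id x))).
apply: (@is_diff_eq _ _ _ _ _ _ _ (is_diff_comp dN fx)).
by apply/funext => v /=; ring.
Qed.

Lemma grad0_littleo f x : f x = 0 ->
  (forall e, 0 < e -> \forall y \near x, `|f y| <= e * `|y - x|) ->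
  is_grad f x 0 0.
Proof.
move=> fx0 fo; apply: (@is_diff_eq _ _ _ _ _ _ _ (is_diff_littleo fx0 fo)).
by apply/funext => v /=; rewrite !mul0r addr0.
Qed.

(** The form in which a computed gradient is used: the function and both
    components are matched up to proved equalities. *)
Lemma eq_grad f g x a b a' b' : is_grad f x a b ->
  (forall y, g y = f y) -> a = a' -> b = b' -> is_grad g x a' b'.
Proof. by move=> fx /funext -> <- <-. Qed.

Lemma near_grad f g x a b : (\forall y \near x, f y = g y) ->
  is_grad f x a b -> is_grad g x a b.
Proof.
move=> fg fx.
have : is_grad (fun y => (g y - f y)) x 0 0.
  apply: grad0_littleo; first by rewrite (nbhs_singleton fg) subrr.
  move=> e e0; near=> y.
  have -> : g y = f y by apply/esym; near: y.
  by rewrite subrr normr0 mulr_ge0 // ltW.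
move=> /(gradD fx); rewrite !addr0.
by congr (is_grad _ _ _ _); apply/funext => y /=; rewrite addrC subrK.
Unshelve. all: by end_near. Qed.

Lemma grad_swap (f : R * R -> R) x a b : is_grad f (x.2, x.1) a b ->
  is_grad (fun y => f (y.2, y.1)) x b a.
Proof.
move=> fx; have ds : is_diff x (fun y : R * R => (y.2, y.1)) (fun v => (v.2, v.1)).
  have d1 := grad_fst x; have d2 := grad_snd x; rewrite /is_grad in d1 d2.
  apply: (@is_diff_eq _ _ _ _ _ _ _ (is_diff_pair d2 d1)).
  by apply/funext => v; rewrite !mul0r !mul1r add0r addr0.
apply: (@is_diff_eq _ _ _ _ _ _ _ (is_diff_comp ds fx)).
by apply/funext => v /=; rewrite addrC.
Qed.

Lemma is_grad_continuous f x a b : is_grad f x a b -> {for x, continuous f}.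
Proof. by case/is_gradE => /differentiable_continuous. Qed.

(** Explicit formulas [A], [B] for the partial derivatives near the point
    replace the operators [derive], which are opaque to computation. *)
Lemma has_laplacianI f A B x a1 a2 b1 b2 l :
  (\forall y \near x, is_grad f y (A y) (B y)) ->
  is_grad A x a1 a2 -> is_grad B x b1 b2 -> a1 + b2 = l ->
  has_laplacian f x l.
Proof.
move=> fAB Ax Bx <-.
have {}Ax : is_grad (fun y => 'D_e1 f y) x a1 a2.
  by apply: near_grad Ax; apply: filterS fAB => y /is_gradE[].
have {}Bx : is_grad (fun y => 'D_e2 f y) x b1 b2.
  by apply: near_grad Bx; apply: filterS fAB => y /is_gradE[].
have [dA A1 _] := is_gradE Ax; have [dB _ B2] := is_gradE Bx.
split=> //; last by rewrite A1 B2.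
by apply: filterS fAB => y /is_gradE[].
Qed.

Lemma has_laplacianE f x l : has_laplacian f x l ->
  exists a1 a2 b1 b2, [/\ \forall y \near x, is_grad f y ('D_e1 f y) ('D_e2 f y),
    is_grad (fun y => 'D_e1 f y) x a1 a2,
    is_grad (fun y => 'D_e2 f y) x b1 b2 & a1 + b2 = l].
Proof.
case=> df /differentiable_grad d1 /differentiable_grad d2 E.
do 4 eexists; split; [|exact: d1|exact: d2|exact: E].
by apply: filterS df => y /differentiable_grad.
Qed.

Lemma has_laplacian_uniq f x l l' :
  has_laplacian f x l -> has_laplacian f x l' -> l = l'.
Proof. by move=> [_ _ _ <-] [_ _ _ <-]. Qed.

(** The partial derivatives agree near [x] because an eventual equality holds
    eventually around every nearby point. *)
Lemma near_laplacian f g x l : (\forall y \near x, f y = g y) ->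
  has_laplacian f x l -> has_laplacian g x l.
Proof.
move=> fg /has_laplacianE[a1 [a2 [b1 [b2 [gr d1 d2 E]]]]].
apply: (has_laplacianI _ d1 d2 E).
have fg' := nbhs_interior fg.
near=> y; apply: (@near_grad f); first by near: y.
by near: y.
Unshelve. all: by end_near. Qed.

Lemma has_laplacianD f g x l l' : has_laplacian f x l -> has_laplacian g x l' ->
  has_laplacian (fun y => f y + g y) x (l + l').
Proof.
move=> /has_laplacianE[a1 [a2 [b1 [b2 [fgr f1 f2 <-]]]]].
move=> /has_laplacianE[c1 [c2 [d1 [d2 [ggr g1 g2 <-]]]]].
apply: (has_laplacianI _ (gradD f1 g1) (gradD f2 g2)); last by rewrite addrACA.
by near=> y; apply: gradD; near: y.
Unshelve. all: by end_near. Qed.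

Lemma has_laplacianZ c f x l : has_laplacian f x l ->
  has_laplacian (fun y => c * f y) x (c * l).
Proof.
move=> /has_laplacianE[a1 [a2 [b1 [b2 [fgr f1 f2 <-]]]]].
apply: (has_laplacianI _ (gradZ c f1) (gradZ c f2)); last by rewrite mulrDr.
by near=> y; apply: gradZ; near: y.
Unshelve. all: by end_near. Qed.

Lemma has_laplacianB f g x l l' : has_laplacian f x l -> has_laplacian g x l' ->
  has_laplacian (fun y => f y - g y) x (l - l').
Proof.
move=> fx /(has_laplacianZ (-1)) /(has_laplacianD fx); rewrite mulN1r.
by apply: near_laplacian; near=> y; rewrite mulN1r.
Unshelve. all: by end_near. Qed.

Lemma has_laplacian_compN f x l : has_laplacian f (- x) l ->
  has_laplacian (fun y => f (- y)) x l.
Proof.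
move=> /has_laplacianE[a1 [a2 [b1 [b2 [fgr f1 f2 <-]]]]].
apply: (has_laplacianI _ (gradN (grad_compN f1)) (gradN (grad_compN f2)));
  last by rewrite !opprK.
have H : \forall y \near x, is_grad f (- y) ('D_e1 f (- y)) ('D_e2 f (- y)).
  have dN : differentiable (fun y : R * R => - y) x.
    by case: (is_diffN (is_diff_id x)).
  exact: (differentiable_continuous dN fgr).
by near=> y; apply: grad_compN; near: y.
Unshelve. all: by end_near. Qed.

Lemma near_fst_lt x c : x.1 < c -> \forall y \near x, y.1 < c.
Proof.
move=> xc; apply: (@cvgr_lt _ _ (nbhs x) _ fst x.1) => //; exact: cvg_fst.
Qed.

Lemma near_fst_gt x c : c < x.1 -> \forall y \near x, c < y.1.
Proof.
move=> xc; apply: (@cvgr_gt _ _ (nbhs x) _ fst x.1) => //; exact: cvg_fst.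
Qed.

Lemma near_snd_lt x c : x.2 < c -> \forall y \near x, y.2 < c.
Proof.
move=> xc; apply: (@cvgr_lt _ _ (nbhs x) _ snd x.2) => //; exact: cvg_snd.
Qed.

Lemma near_snd_gt x c : c < x.2 -> \forall y \near x, c < y.2.
Proof.
move=> xc; apply: (@cvgr_gt _ _ (nbhs x) _ snd x.2) => //; exact: cvg_snd.
Qed.

Lemma has_laplacian_quadratic a b x :
  has_laplacian (fun y => a * y.1 ^+ 2 + b * y.2 ^+ 2) x (2 * a + 2 * b).
Proof.
apply: (has_laplacianI (A := fun y => 2 * a * y.1) (B := fun y => 2 * b * y.2)).
- near=> y.
  have G := gradD (gradZ a (gradM (grad_fst y) (grad_fst y)))
    (gradZ b (gradM (grad_snd y) (grad_snd y))).
  by apply: (eq_grad G) => [z||] //=; ring.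
- exact: gradZ (grad_fst x).
- exact: gradZ (grad_snd x).
- by ring.
Unshelve. all: by end_near. Qed.

End gradient.

(** * The Euclidean norm *)

Section euclidean_norm.
Context {R : realType}.
Implicit Types (x y : R * R) (a b r s t : R).

Lemma enorm_ge0 x : 0 <= enorm x. Proof. exact: sqrtr_ge0. Qed.

Lemma enorm_sqr x : enorm x ^+ 2 = x.1 ^+ 2 + x.2 ^+ 2.
Proof. by rewrite sqr_sqrtr // addr_ge0 // sqr_ge0. Qed.

Lemma normr1_le_enorm x : `|x.1| <= enorm x.
Proof.
by rewrite -ler_sqr ?nnegrE ?enorm_ge0 // enorm_sqr real_normK ?num_real // lerDl sqr_ge0.
Qed.

Lemma normr2_le_enorm x : `|x.2| <= enorm x.
Proof.
by rewrite -ler_sqr ?nnegrE ?enorm_ge0 // enorm_sqr real_normK ?num_real // lerDr sqr_ge0.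
Qed.

Lemma enorm_eq0 x : (enorm x == 0) = (x == 0).
Proof.
apply/eqP/eqP => [x0|->]; last by rewrite /enorm /= expr0n /= addr0 sqrtr0.
case: x x0 => a b x0.
have := normr1_le_enorm (a, b); have := normr2_le_enorm (a, b); rewrite x0 /=.
by rewrite !normr_le0 => /eqP -> /eqP ->.
Qed.

Lemma enorm_gt0 x : (0 < enorm x) = (x != 0).
Proof. by rewrite lt_def enorm_eq0 enorm_ge0 andbT. Qed.

Lemma enormN x : enorm (- x) = enorm x.
Proof. by rewrite /enorm /= !sqrrN. Qed.

Lemma enorm_swap x : enorm (x.2, x.1) = enorm x.
Proof. by rewrite /enorm /= addrC. Qed.

Lemma enormD x y : enorm (x + y) <= enorm x + enorm y.
Proof.
rewrite -ler_sqr ?nnegrE ?addr_ge0 ?enorm_ge0 // sqrrD !enorm_sqr /=.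
have : x.1 * y.1 + x.2 * y.2 <= enorm x * enorm y.
  rewrite (le_trans (ler_norm _)) // -ler_sqr ?nnegrE ?mulr_ge0 ?enorm_ge0 //.
  rewrite real_normK ?num_real // exprMn !enorm_sqr -subr_ge0.
  rewrite (_ : _ - _ = (x.1 * y.2 - x.2 * y.1) ^+ 2) ?sqr_ge0 //; ring.
rewrite -mulr_natl; nra.
Qed.

Lemma enormB x y : enorm (x - y) = enorm (y - x).
Proof. by rewrite -enormN opprB. Qed.

Lemma ler_enormD x y : enorm (x - y) <= enorm x + enorm y.
Proof. by rewrite (le_trans (enormD _ _)) // enormN. Qed.

Lemma ler_dist_enorm x y : `|enorm x - enorm y| <= enorm (x - y).
Proof.
have := enormD (x - y) y; have := enormD (y - x) x.
by rewrite !subrK (enormB y x) ler_norml => ? ?; apply/andP; split; lra.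
Qed.

Lemma enorm_continuous : continuous (@enorm R).
Proof.
move=> x; apply: (@continuous_comp _ _ _ (fun x : R * R => x.1 ^+ 2 + x.2 ^+ 2)
  (@Num.sqrt R)); last exact: sqrt_continuous.
have := gradD (gradM (grad_fst x) (grad_fst x)) (gradM (grad_snd x) (grad_snd x)).
exact: is_grad_continuous.
Qed.

End euclidean_norm.

(** * Polar coordinates *)

Section polar_coordinates.
Context {R : realType}.
Implicit Types (x y : R * R) (a b r s t M : R).

(** The mean value theorem on [[0, d / 2]] gives
    [d / 2 * cos (M / 2) <= sin (d / 2)]; then [sin d = 2 sin (d / 2) cos (d / 2)]. *)
Lemma le_mul_sin M d : 0 <= d <= M -> M <= pi -> d * cos (M / 2) ^+ 2 <= sin d.
Proof.
move=> /andP[d0 dM] Mpi.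
have cos_le t : 0 <= t <= d / 2 -> cos (M / 2) <= cos t.
  move=> /andP[t0 td]; have [->//|tM] := eqVneq t (M / 2).
  by rewrite ltW // ltr_cos ?in_itv /=; lra.
have cM : 0 <= cos (M / 2) by apply: cos_ge0_pihalf; lra.
have sin_le : d / 2 * cos (M / 2) <= sin (d / 2).
  have d20 : 0 <= d / 2 by lra.
  have [|c cd] := @MVT_segment R sin cos 0 (d / 2) d20.
    by apply: continuous_subspaceT => z; exact: continuous_sin.
  rewrite sin0 !subr0 => ->; rewrite mulrC ler_wpM2r //.
  by apply: cos_le; rewrite in_itv in cd.
have cd : cos (M / 2) <= cos (d / 2) by apply: cos_le; lra.
have -> : sin d = 2 * (sin (d / 2) * cos (d / 2)).
  rewrite {1}(_ : d = (d / 2) *+ 2) ?sin_mulr2n; last by rewrite -mulr_natr; field.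
  by rewrite -mulr_natl mulrC (mulrC (cos _)) mulrC.
have -> : d * cos (M / 2) ^+ 2 = 2 * (d / 2 * cos (M / 2) * cos (M / 2)) by field.
rewrite ler_pM2l // ler_pM // mulr_ge0 //; lra.
Qed.

(** With [k = |cos ((t - t') / 2)|] the difference of the squares is
    [(r - s k)^2 + 2 r s (1 - k) (1 + 2 k)]. *)
Lemma enorm_polarB r s t t' : 0 <= r -> 0 <= s ->
  s * `|sin ((t - t') / 2)| <= enorm (polar r t - polar s t').
Proof.
move=> r0 s0; rewrite -ler_sqr ?nnegrE ?mulr_ge0 ?enorm_ge0 //.
rewrite exprMn real_normK ?num_real // enorm_sqr /=.
set k := `|cos ((t - t') / 2)|.
have k1 : k <= 1 by exact: cos_max.
have k0 : 0 <= k by exact: normr_ge0.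
have kE : cos ((t - t') / 2) ^+ 2 = k ^+ 2 by rewrite real_normK ?num_real.
have -> : sin ((t - t') / 2) ^+ 2 = 1 - k ^+ 2 by rewrite sin2cos2 kE.
have cE : cos t * cos t' + sin t * sin t' = 2 * k ^+ 2 - 1.
  rewrite -cosB {1}(_ : t - t' = ((t - t') / 2) *+ 2) ?cos_mulr2n ?kE ?mulr_natl //.
  by rewrite -mulr_natr; field.
have -> : (r * cos t - s * cos t') ^+ 2 + (r * sin t - s * sin t') ^+ 2 =
   r ^+ 2 * (cos t ^+ 2 + sin t ^+ 2) + s ^+ 2 * (cos t' ^+ 2 + sin t' ^+ 2) -
   2 * r * s * (cos t * cos t' + sin t * sin t') by ring.
rewrite !cos2Dsin2 cE -subr_ge0.
have -> : r ^+ 2 * 1 + s ^+ 2 * 1 - 2 * r * s * (2 * k ^+ 2 - 1) - s ^+ 2 * (1 - k ^+ 2)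
  = (r - s * k) ^+ 2 + 2 * r * s * ((1 - k) * (1 + 2 * k)) by ring.
rewrite addr_ge0 ?sqr_ge0 // !mulr_ge0 //; lra.
Qed.

(** For angles that differ by at most [M < 2 pi] the distance controls the
    arc length; [M = 2 pi] fails for two points on both sides of a cut. *)
Lemma polar_lip M : 0 <= M < 2 * pi -> exists2 C : R, 0 < C &
  forall r s t t', 0 <= r -> 0 <= s -> `|t - t'| <= M ->
    s * `|t - t'| <= C * enorm (polar r t - polar s t').
Proof.
move=> /andP[M0 Mpi].
have cM : 0 < cos (M / 4) by apply: cos_gt0_pihalf; lra.
exists (2 / cos (M / 4) ^+ 2); first by rewrite divr_gt0 // exprn_gt0.
move=> r s t t' r0 s0 tM; rewrite mulrAC ler_pdivlMr ?exprn_gt0 //.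
have d0 := normr_ge0 (t - t').
have := @le_mul_sin (M / 2) (`|t - t'| / 2).
rewrite (_ : M / 2 / 2 = M / 4); last by field.
move=> /(_ ltac:(lra) ltac:(lra)) sd.
have := enorm_polarB t t' r0 s0.
have -> : `|sin ((t - t') / 2)| = sin (`|t - t'| / 2).
  rewrite -[RHS]ger0_norm; last by apply: sin_ge0_pi; lra.
  have [tt'|tt'] := leP 0 (t - t'); first by rewrite (ger0_norm tt').
  by rewrite (ltr0_norm tt') mulNr sinN normrN.
move=> sE; rewrite -mulrA.
have := ler_wpM2l s0 sd; lra.
Qed.

(** All formulas for [angle] below come from this one by rotating a half-plane
    onto [a > 0] and using that polar coordinates are unique. *)
Lemma polar_atan a b : 0 < a -> (a, b) = polar (enorm (a, b)) (atan (b / a)).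
Proof.
move=> a0; have q0 : 0 < Num.sqrt (1 + (b / a) ^+ 2).
  by rewrite sqrtr_gt0 ltr_pwDl // sqr_ge0.
have nE : enorm (a, b) = a * Num.sqrt (1 + (b / a) ^+ 2).
  rewrite -[X in X * _](gtr0_norm a0) -sqrtr_sqr -sqrtrM ?sqr_ge0 //.
  by congr Num.sqrt; rewrite /=; field; rewrite gt_eqF.
have cE : cos (atan (b / a)) = (Num.sqrt (1 + (b / a) ^+ 2))^-1 by exact: cos_atan.
have sE : sin (atan (b / a)) = b / a * cos (atan (b / a)).
  by have {2}<- := atanK (b / a); rewrite /tan divfK // cE invr_eq0 gt_eqF.
rewrite /polar sE cE nE; congr (_, _); field; rewrite ?gt_eqF //.
Qed.

Lemma atan_bnd a : - (pi / 2) < atan a < pi / 2.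
Proof. by rewrite atan_gtNpi2 atan_ltpi2. Qed.

Lemma angle_up x : 0 < x.2 -> angle x = pi / 2 - atan (x.1 / x.2).
Proof.
case: x => a b /= b0; have /andP[A1 A2] := atan_bnd (a / b).
have [bE aE] := polar_atan a b0.
have r0 : 0 < enorm (b, a) by rewrite enorm_gt0; apply/eqP => -[] /eqP; rewrite gt_eqF.
have -> : (a, b) = polar (enorm (b, a)) (pi / 2 - atan (a / b)).
  rewrite /polar cosB sinB cos_pihalf sin_pihalf.
  by congr (_, _); [rewrite [LHS]aE | rewrite [LHS]bE]; ring.
by apply: (polarK r0 _).2; have := @pi_gt0 R; lra.
Qed.

Lemma angle_down x : x.2 < 0 -> angle x = 3 * pi / 2 - atan (x.1 / x.2).
Proof.
case: x => a b /= b0; have /andP[A1 A2] := atan_bnd (a / b).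
have b0' : 0 < - b by rewrite oppr_gt0.
have [bE aE] := polar_atan (- a) b0'.
have r0 : 0 < enorm (- b, - a) by rewrite enorm_gt0; apply/eqP => -[] /eqP; rewrite gt_eqF.
have -> : (a, b) = polar (enorm (- b, - a)) (3 * pi / 2 - atan (a / b)).
  rewrite (_ : 3 * pi / 2 - _ = pi / 2 - atan (a / b) + pi); last by field.
  rewrite invrN mulrNN in bE aE.
  rewrite /polar sinDpi cosDpi cosB sinB cos_pihalf sin_pihalf.
  by congr (_, _); apply: oppr_inj; [rewrite [LHS]aE | rewrite [LHS]bE]; ring.
by apply: (polarK r0 _).2; have := @pi_gt0 R; lra.
Qed.

Lemma angle_left x : x.1 < 0 -> angle x = pi + atan (x.2 / x.1).
Proof.
case: x => a b /= a0; have /andP[A1 A2] := atan_bnd (b / a).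
have a0' : 0 < - a by rewrite oppr_gt0.
have [aE bE] := polar_atan (- b) a0'.
have r0 : 0 < enorm (- a, - b) by rewrite enorm_gt0; apply/eqP => -[] /eqP; rewrite gt_eqF.
have -> : (a, b) = polar (enorm (- a, - b)) (pi + atan (b / a)).
  rewrite invrN mulrNN in aE bE.
  rewrite /polar (addrC pi) sinDpi cosDpi.
  by congr (_, _); apply: oppr_inj; [rewrite [LHS]aE | rewrite [LHS]bE]; ring.
by apply: (polarK r0 _).2; have := @pi_gt0 R; lra.
Qed.

Lemma angle_Q1 x : 0 < x.1 -> 0 < x.2 -> angle x = atan (x.2 / x.1).
Proof.
case: x => a b /= a0 b0; have /andP[A1 A2] := atan_bnd (b / a).
have r0 : 0 < enorm (a, b) by rewrite enorm_gt0; apply/eqP => -[] /eqP; rewrite gt_eqF.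
rewrite {1}(polar_atan b a0); apply: (polarK r0 _).2.
have : 0 < atan (b / a) by rewrite -(@atan0 R) lt_atan // divr_gt0.
by have := @pi_gt0 R; lra.
Qed.

(** The cut is included: there the angle is [2 pi], not 0. *)
Lemma angle_Q4 x : 0 < x.1 -> x.2 <= 0 -> angle x = 2 * pi + atan (x.2 / x.1).
Proof.
case: x => a b /= a0 b0; have /andP[A1 A2] := atan_bnd (b / a).
have r0 : 0 < enorm (a, b) by rewrite enorm_gt0; apply/eqP => -[] /eqP; rewrite gt_eqF.
have -> : (a, b) = polar (enorm (a, b)) (2 * pi + atan (b / a)).
  rewrite {1}(polar_atan b a0) /polar addrC (_ : 2 * pi = pi *+ 2) ?mulr_natl //.
  by rewrite cosD2pi sinD2pi.
apply: (polarK r0 _).2.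
have : atan (b / a) <= 0.
  by rewrite -(@atan0 R) le_atan // pmulr_lle0 // invr_gt0.
by have := @pi_gt0 R; lra.
Qed.

Lemma polar_ex x : x != 0 -> exists r t, [/\ 0 < r, 0 < t <= 2 * pi & x = polar r t].
Proof.
have pi0 := @pi_gt0 R.
case: x => a b x0; have [a0|a0|a0] := ltgtP a 0.
- have a0' : 0 < - a by rewrite oppr_gt0.
  have /andP[A1 A2] := atan_bnd (- b / - a).
  exists (enorm (- a, - b)), (atan (- b / - a) + pi); split.
  + by rewrite enorm_gt0; apply/eqP => -[] /eqP; rewrite gt_eqF.
  + lra.
  + have [aE bE] := polar_atan (- b) a0'.
    rewrite /polar sinDpi cosDpi.
    by congr (_, _); apply: oppr_inj; [rewrite [LHS]aE | rewrite [LHS]bE]; ring.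
- have /andP[A1 A2] := atan_bnd (b / a).
  have r0 : 0 < enorm (a, b) by rewrite enorm_gt0.
  have [t0|t0] := ltP 0 (atan (b / a)).
    by exists (enorm (a, b)), (atan (b / a)); split=> //; [lra | exact: polar_atan].
  exists (enorm (a, b)), (atan (b / a) + pi *+ 2); split=> //.
    by rewrite -mulr_natl; lra.
  by rewrite {1}(polar_atan b a0) /polar cosD2pi sinD2pi.
- rewrite {a}a0 in x0 *; have [b0|b0|b0] := ltgtP b 0.
  + exists (- b), (pi / 2 + pi); split; [lra | lra |].
    by rewrite /polar cosDpi sinDpi cos_pihalf sin_pihalf; congr (_, _); ring.
  + exists b, (pi / 2); split; [lra | lra |].
    by rewrite /polar cos_pihalf sin_pihalf; congr (_, _); ring.
  + by rewrite b0 eqxx in x0.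
Qed.

Lemma angleK x : x != 0 -> x = polar (enorm x) (angle x).
Proof. by case/polar_ex=> r [t [r0 t0 ->]]; have [-> ->] := polarK r0 t0. Qed.

Lemma sqr_cos2_angle x : x != 0 ->
  enorm x ^+ 2 * cos (2 * angle x) = x.1 ^+ 2 - x.2 ^+ 2.
Proof.
move=> x0; have := angleK x0; move: (enorm x) (angle x) => r t xE.
have -> : x.1 = r * cos t by rewrite xE.
have -> : x.2 = r * sin t by rewrite xE.
rewrite mulr_natl cos_mulr2n -[cos t ^+ 2 *+ 2]mulr_natl.
by rewrite !exprMn sin2cos2; ring.
Qed.

Lemma sqr_sin2_angle x : x != 0 -> enorm x ^+ 2 * sin (2 * angle x) = 2 * x.1 * x.2.
Proof.
move=> x0; have := angleK x0; move: (enorm x) (angle x) => r t xE.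
have -> : x.1 = r * cos t by rewrite xE.
have -> : x.2 = r * sin t by rewrite xE.
by rewrite mulr_natl sin_mulr2n -[(cos t * sin t) *+ 2]mulr_natl; ring.
Qed.

(** Both sides are the angle of [(b, a)], read in the right and in the upper
    half-plane. *)
Lemma atanV a b : 0 < a -> 0 < b -> atan (a / b) = pi / 2 - atan (b / a).
Proof.
move=> a0 b0; have := @angle_up (a, b) b0; rewrite angle_Q1 //= => ->; ring.
Qed.

Lemma atanVN a b : a < 0 -> b < 0 -> atan (a / b) = pi / 2 - atan (b / a).
Proof.
move=> a0 b0; have := @atanV (- a) (- b); rewrite !oppr_gt0 !invrN !mulrNN.
exact.
Qed.

Lemma atanV_lt0 a b : a * b < 0 -> atan (a / b) = - (pi / 2) - atan (b / a).
Proof.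
move=> ab; have [a0|a0] := ltP a 0.
  have b0 : 0 < b by rewrite -(nmulr_rlt0 _ a0).
  have := @atanV (- a) b; rewrite oppr_gt0 invrN mulNr mulrN !atanN => /(_ a0 b0); lra.
have a1 : 0 < a by rewrite lt_def a0 andbT; apply: contraTneq ab => ->; rewrite mul0r ltxx.
have b0 : b < 0 by rewrite -(pmulr_rlt0 _ a1).
have := @atanV a (- b); rewrite oppr_gt0 invrN mulNr mulrN !atanN => /(_ a1 b0); lra.
Qed.

Lemma angle_le_pihalf x : x != 0 -> (angle x <= pi / 2) = (0 <= x.1) && (0 < x.2).
Proof.
move=> x0; have pi0 := @pi_gt0 R.
have [x2|x2|x2] := ltgtP x.2 0.
- rewrite angle_down // andbF; have /andP[A B] := atan_bnd (x.1 / x.2).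
  apply/negbTE; rewrite -ltNge; lra.
- rewrite angle_up // andbT lerBlDr lerDl.
  have [x1|x1] := leP 0 x.1.
    by rewrite -[X in X <= _](@atan0 R); apply: le_atan; rewrite divr_ge0 // ltW.
  apply/negbTE; rewrite -ltNge -[ltRHS](@atan0 R); apply: lt_atan.
  by rewrite pmulr_llt0 // invr_gt0.
rewrite andbF; apply/negbTE; rewrite -ltNge.
have [x1|x1|x1] := ltgtP x.1 0.
- rewrite angle_left // x2 mul0r atan0; lra.
- rewrite angle_Q4 ?x2 // mul0r atan0; lra.
- by move: x0; rewrite (surjective_pairing x) x1 x2 eqxx.
Qed.

Lemma angle_le_pi x : x != 0 ->
  (angle x <= pi) = (0 < x.2) || ((x.2 == 0) && (x.1 < 0)).
Proof.
move=> x0; have pi0 := @pi_gt0 R.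
have [x2|x2|x2] := ltgtP x.2 0.
- rewrite angle_down //=; have /andP[A B] := atan_bnd (x.1 / x.2).
  by apply/negbTE; rewrite -ltNge; lra.
- by rewrite angle_up //=; have /andP[A B] := atan_bnd (x.1 / x.2); lra.
have [x1|x1|x1] := ltgtP x.1 0 => /=.
- by rewrite angle_left // x2 mul0r atan0 addr0 lexx.
- rewrite angle_Q4 ?x2 // mul0r atan0; apply/negbTE; rewrite -ltNge; lra.
- by move: x0; rewrite (surjective_pairing x) x1 x2 eqxx.
Qed.

Lemma angle_le_3pihalf x : x != 0 -> (angle x <= pi) = false ->
  (angle x <= 3 * pi / 2) = (x.1 <= 0).
Proof.
move=> x0 /negbT; rewrite angle_le_pi //; have pi0 := @pi_gt0 R.
have [x2|x2|x2] //= := ltgtP x.2 0.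
  move=> _; rewrite angle_down // lerBlDr lerDl.
  have [x1|x1] := leP x.1 0.
    by rewrite -[X in X <= _](@atan0 R); apply: le_atan; rewrite mulr_le0 // invr_le0 ltW.
  apply/negbTE; rewrite -ltNge -[ltRHS](@atan0 R); apply: lt_atan.
  by rewrite pmulr_rlt0 // invr_lt0.
have [x1|x1|x1] //= := ltgtP x.1 0; last first.
  by move: x0; rewrite (surjective_pairing x) x1 x2 eqxx.
by move=> _; rewrite angle_Q4 ?x2 // mul0r atan0; apply/negbTE; rewrite -ltNge; lra.
Qed.

End polar_coordinates.

(** * Lipschitz and Hoelder functions *)

Section holder.
Context {R : realType}.
Implicit Types (x y : R * R) (a b c g : R) (f k : R * R -> R) (A : set (R * R)).

Definition lip_on A f := exists C, forall x y, A x -> A y ->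
  `|f x - f y| <= C * enorm (x - y).

Definition holder_on A g f := exists C, forall x y, A x -> A y ->
  `|f x - f y| <= C * enorm (x - y) `^ g.

Lemma lip_holder1 A f : lip_on A f <-> holder_on A 1 f.
Proof.
by split=> -[C fC]; exists C => x y Ax Ay;
  have := fC x y Ax Ay; rewrite powRr1 ?enorm_ge0.
Qed.

Lemma holder_onD A g f k : holder_on A g f -> holder_on A g k ->
  holder_on A g (fun x => f x + k x).
Proof.
move=> [C fC] [D kD]; exists (C + D) => x y Ax Ay.
rewrite opprD addrACA mulrDl (le_trans (ler_normD _ _)) // lerD //; first exact: fC.
exact: kD.
Qed.

Lemma holder_onZ A g c f : holder_on A g f -> holder_on A g (fun x => c * f x).
Proof.
move=> [C fC]; exists (`|c| * C) => x y Ax Ay.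
by rewrite -mulrBr normrM -mulrA ler_wpM2l //; exact: fC.
Qed.

Lemma lip_onZ A c f : lip_on A f -> lip_on A (fun x => c * f x).
Proof. by move=> /lip_holder1 ?; apply/lip_holder1; exact: holder_onZ. Qed.

Lemma lip_on_subset A B f : A `<=` B -> lip_on B f -> lip_on A f.
Proof. by move=> AB [C fC]; exists C => x y /AB Bx /AB By; exact: fC. Qed.

Lemma holder_on_subset A B g f : A `<=` B -> holder_on B g f -> holder_on A g f.
Proof. by move=> AB [C fC]; exists C => x y /AB Bx /AB By; exact: fC. Qed.

Lemma lip_on_fst A : lip_on A fst.
Proof. by exists 1 => x y _ _; rewrite mul1r; exact: normr1_le_enorm (x - y). Qed.

Lemma lip_on_snd A : lip_on A snd.
Proof. by exists 1 => x y _ _; rewrite mul1r; exact: normr2_le_enorm (x - y). Qed.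

Lemma lip_on_norm A f : lip_on A f -> lip_on A (fun x => `|f x|).
Proof.
move=> [C fC]; exists C => x y Ax Ay.
exact: le_trans (ler_dist_dist _ _) (fC x y Ax Ay).
Qed.

(** On a set of diameter at most 2 a Lipschitz bound implies a Hoelder bound. *)
Lemma le_powR_ball g (d : R) : 0 < g < 1 -> 0 <= d <= 2 -> d <= 2 * d `^ g.
Proof.
move=> /andP[g0 g1] /andP[d0 d2]; rewrite -{1}(powRr1 d0).
rewrite -[X in d `^ X](subrK g) powRD; last by rewrite subrK oner_eq0.
rewrite ler_wpM2r ?powR_ge0 // (@le_trans _ _ (2 `^ (1 - g))) //.
  by apply: ge0_ler_powR; rewrite ?nnegrE //; lra.
by apply: ler1_powR; lra.
Qed.

Lemma unit_ball_dist x y : unit_ball x -> unit_ball y -> 0 <= enorm (x - y) <= 2.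
Proof.
rewrite /unit_ball /= enorm_ge0 => x1 y1 /=.
by rewrite (le_trans (ler_enormD _ _)) // (_ : 2 = 1 + 1 :> R) ?lerD ?ltW.
Qed.

Lemma lip_holder_ball A g f : 0 < g < 1 -> A `<=` unit_ball -> lip_on A f ->
  holder_on A g f.
Proof.
move=> g01 A1 [C fC]; exists (`|C| * 2) => x y Ax Ay.
rewrite (le_trans (fC x y Ax Ay)) // (@le_trans _ _ (`|C| * enorm (x - y))) //.
  by rewrite ler_wpM2r ?enorm_ge0 // ler_norm.
by rewrite -mulrA ler_wpM2l // le_powR_ball // unit_ball_dist //; exact: A1.
Qed.

Lemma C1holderI A g f (a b : R * R -> R) : (forall x, A x -> is_grad f x (a x) (b x)) ->
  holder_on A g a -> holder_on A g b -> C1holder A g f.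
Proof.
move=> fab [C aC] [D bD]; split; first by move=> x /fab/is_gradE[].
exists (Num.max C D) => x y Ax Ay.
have [_ -> ->] := is_gradE (fab x Ax); have [_ -> ->] := is_gradE (fab y Ay).
split.
  by rewrite (le_trans (aC x y Ax Ay)) // ler_wpM2r ?powR_ge0 // le_max lexx.
by rewrite (le_trans (bD x y Ax Ay)) // ler_wpM2r ?powR_ge0 // le_max lexx orbT.
Qed.

(** This gives the continuity of [x1 ln |x|] at the origin. *)
Lemma holder_on_continuous A g f x : open A -> A x -> 0 < g -> holder_on A g f ->
  {for x, continuous f}.
Proof.
move=> Ao Ax g0 [C fC]; apply/cvgrPdist_lt => e e0.
pose D := `|C| + 1; have D0 : 0 < D by rewrite ltr_wpDl.
have eD0 : 0 < e / D by rewrite divr_gt0.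
have dx0 : (fun y => enorm (x - y)) y @[y --> x] --> (0 : R).
  have -> : (0 : R) = enorm (x - x) by rewrite subrr; apply/esym/eqP; rewrite enorm_eq0.
  apply: (@continuous_comp _ _ _ (fun y => x - y) (@enorm R)).
    by apply: (@cvgB _ _ _ _ _ (fun=> x) id); [exact: cvg_cst | exact: cvg_id].
  exact: enorm_continuous.
have n0 : 0 < (e / D) `^ g^-1 by rewrite powR_gt0.
near=> y.
have Ay : A y by near: y; move: Ao; rewrite openE; exact.
rewrite (le_lt_trans (fC x y Ax Ay)) // (@le_lt_trans _ _ (D * enorm (x - y) `^ g)) //.
  by rewrite ler_wpM2r ?powR_ge0 // (le_trans (ler_norm _)) // lerDl.
rewrite mulrC -ltr_pdivlMr //.
have -> : e / D = ((e / D) `^ g^-1) `^ g.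
  by rewrite -powRrM mulVf ?gt_eqF // powRr1 // ltW.
apply: gt0_ltr_powR => //; rewrite ?nnegrE ?enorm_ge0 ?powR_ge0 //.
near: y; have /cvgrPdist_lt /(_ _ n0) := dx0; apply: filterS => y.
by rewrite sub0r normrN ger0_norm // enorm_ge0.
Unshelve. all: by end_near. Qed.

Lemma lip_on_continuous f : lip_on setT f -> continuous f.
Proof.
move=> /lip_holder1 fl x.
by apply: (holder_on_continuous openT _ ltr01 fl).
Qed.

(** A finer form of the hypothesis, whose parts are closed under sums and
    multiples. *)
Lemma C1holderE A g f : C1holder A g f ->
  [/\ forall x, A x -> is_grad f x ('D_e1 f x) ('D_e2 f x),
      holder_on A g (fun x => 'D_e1 f x) & holder_on A g (fun x => 'D_e2 f x)].
Proof.
move=> [df [C fC]]; split.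
- by move=> x Ax; apply: differentiable_grad; exact: df.
- by exists C => x y Ax Ay; exact: (fC x y Ax Ay).1.
- by exists C => x y Ax Ay; exact: (fC x y Ax Ay).2.
Qed.

Lemma C1holderD A g f k : C1holder A g f -> C1holder A g k ->
  C1holder A g (fun x => f x + k x).
Proof.
move=> /C1holderE[fG f1 f2] /C1holderE[kG k1 k2].
apply: C1holderI (holder_onD f1 k1) (holder_onD f2 k2) => x Ax.
exact: gradD (fG x Ax) (kG x Ax).
Qed.

Lemma C1holderZ A g c f : C1holder A g f -> C1holder A g (fun x => c * f x).
Proof.
move=> /C1holderE[fG f1 f2].
apply: C1holderI (holder_onZ c f1) (holder_onZ c f2) => x Ax.
exact: gradZ (fG x Ax).
Qed.

Lemma C1holder_near A g f k : (forall x, A x -> \forall y \near x, f y = k y) ->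
  C1holder A g f -> C1holder A g k.
Proof.
move=> fk /C1holderE[fG f1 f2]; apply: C1holderI f1 f2 => x Ax.
exact: near_grad (fk x Ax) (fG x Ax).
Qed.

Lemma C1holder_subset A B g f : A `<=` B -> C1holder B g f -> C1holder A g f.
Proof.
move=> AB [df [C fC]]; split; first by move=> x /AB; exact: df.
by exists C => x y /AB Bx /AB By; exact: fC.
Qed.

Lemma C1I (f a b : R * R -> R) : (forall x, is_grad f x (a x) (b x)) ->
  continuous a -> continuous b -> C1 f.
Proof.
move=> fab ac bc; split; first by move=> x; case/is_gradE: (fab x).
  by rewrite (_ : 'D_e1 f = a) //; apply/funext => x; case/is_gradE: (fab x).
by rewrite (_ : 'D_e2 f = b) //; apply/funext => x; case/is_gradE: (fab x).
Qed.

Lemma continuous_mul_cst c (f : R * R -> R) : continuous f ->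
  continuous (fun x => c * f x).
Proof. by move=> fc x; apply: cvgM; [exact: cvg_cst | exact: fc]. Qed.

Lemma continuous_add (f k : R * R -> R) : continuous f -> continuous k ->
  continuous (fun x => f x + k x).
Proof. by move=> fc kc x; apply: cvgD; [exact: fc | exact: kc]. Qed.

Lemma C1D f k : C1 f -> C1 k -> C1 (fun x => f x + k x).
Proof.
move=> [df f1 f2] [dk k1 k2]; apply: C1I.
- by move=> x; apply: gradD; exact: differentiable_grad.
- exact: (continuous_add f1 k1).
- exact: (continuous_add f2 k2).
Qed.

Lemma C1Z c f : C1 f -> C1 (fun x => c * f x).
Proof.
move=> [df f1 f2]; apply: C1I.
- by move=> x; apply: gradZ; exact: differentiable_grad.
- exact: (continuous_mul_cst f1).
- exact: (continuous_mul_cst f2).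
Qed.

Lemma C1B f k : C1 f -> C1 k -> C1 (fun x => f x - k x).
Proof.
move=> fC kC; rewrite (_ : (fun _ => _) = fun x => f x + -1 * k x).
  exact/C1D/C1Z.
by apply/funext => x; rewrite mulN1r.
Qed.

End holder.

(** * The Lipschitz and the logarithmic part of the gradients *)

Section model_functions.
Context {R : realType}.
Implicit Types (x y : R * R) (a b c g : R).

(** [|a|] times the polar angle of [(|a|, b)]; for [a = 0] the convention
    [b / 0 = 0] gives the continuous value 0. *)
Definition homat a b := a * atan (b / a).

Lemma homat_norm a b : homat a b = homat `|a| b.
Proof.
have [a0|a0] := leP 0 a; first by rewrite ger0_norm.
by rewrite ltr0_norm // /homat invrN mulrN atanN mulrNN.
Qed.

Lemma norm_atan_lt a : `|atan a| < pi / 2.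
Proof. by rewrite ltr_norml atan_bnd. Qed.

Lemma norm_homat a b : `|homat a b| <= pi * `|a|.
Proof.
rewrite /homat normrM mulrC ler_wpM2r // (le_trans (ltW (norm_atan_lt _))) //.
by have := @pi_gt0 R; lra.
Qed.

(** The function is even in its first argument, so both points may be moved to
    the right half-plane, where their angles differ by at most [pi].  If one
    first coordinate is 0 the bound [norm_homat] suffices. *)
Lemma homat_lip : lip_on setT (fun x => homat x.1 x.2).
Proof.
have pi0 := @pi_gt0 R.
have [|C C0 CP] := @polar_lip R pi; first by lra.
exists (C + pi) => x y _ _.
have d1 : `| `|x.1| - `|y.1| | <= enorm (x - y).
  exact: le_trans (ler_dist_dist _ _) (normr1_le_enorm (x - y)).
have n0 := enorm_ge0 (x - y).
have Cn0 : 0 <= C * enorm (x - y) by rewrite mulr_ge0 // ltW.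
have [x0|x0] := eqVneq x.1 0.
  rewrite x0 {1}/homat mul0r sub0r normrN (le_trans (norm_homat _ _)) //.
  rewrite x0 normr0 sub0r normrN normr_id in d1.
  by have := ler_wpM2l (ltW pi0) d1; lra.
have [y0|y0] := eqVneq y.1 0.
  rewrite y0 {2}/homat mul0r subr0 (le_trans (norm_homat _ _)) //.
  rewrite y0 normr0 subr0 normr_id in d1.
  by have := ler_wpM2l (ltW pi0) d1; lra.
rewrite (homat_norm x.1) (homat_norm y.1).
have x0' : 0 < `|x.1| by rewrite normr_gt0.
have y0' : 0 < `|y.1| by rewrite normr_gt0.
set p := `|x.1| in d1 x0' *; set q := `|y.1| in d1 y0' *.
have P1 := polar_atan x.2 x0'; have P2 := polar_atan y.2 y0'.
have := CP _ _ (atan (x.2 / p)) (atan (y.2 / q)) (enorm_ge0 (p, x.2)) (enorm_ge0 (q, y.2)).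
rewrite -P1 -P2.
have le2 : enorm ((p, x.2) - (q, y.2)) <= enorm (x - y).
  rewrite -ler_sqr ?nnegrE ?enorm_ge0 // !enorm_sqr /= lerD2r.
  rewrite -[leLHS]real_normK ?num_real // -[leRHS]real_normK ?num_real //.
  by rewrite ler_sqr ?nnegrE //; exact: ler_dist_dist.
have /andP[A1 A2] := atan_bnd (x.2 / p); have /andP[B1 B2] := atan_bnd (y.2 / q).
have AB : `|atan (x.2 / p) - atan (y.2 / q)| <= pi.
  by rewrite ler_norml; apply/andP; split; lra.
move=> /(_ AB) AB2.
have qn : q <= enorm (q, y.2).
  by have := normr1_le_enorm (q, y.2); rewrite /= ger0_norm // ltW.
rewrite /homat; set a1 := atan _ in A1 A2 AB AB2 *; set b1 := atan _ in B1 B2 AB AB2 *.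
have -> : p * a1 - q * b1 = (p - q) * a1 + q * (a1 - b1) by ring.
rewrite (le_trans (ler_normD _ _)) // !normrM (gtr0_norm y0') [leRHS]mulrDl addrC lerD //.
  rewrite (@le_trans _ _ (enorm (q, y.2) * `|a1 - b1|)) ?ler_wpM2r //.
  by rewrite (le_trans AB2) // ler_wpM2l // ltW.
rewrite mulrC ler_pM //; rewrite ler_norml; apply/andP; split; lra.
Qed.

Lemma lip_on_swap (f : R * R -> R) : lip_on setT f ->
  lip_on setT (fun x => f (x.2, x.1)).
Proof.
move=> [C fC]; exists C => x y _ _.
rewrite (le_trans (fC _ _ I I)) // /enorm /= addrC //.
Qed.

(** The logarithms are compared by [s (ln r - ln s) <= r - s], so that only the
    logarithm of the larger radius remains. *)
Lemma ln_lip (p q r s d : R) : `|p - q| <= d -> `|q| <= s -> 0 <= s <= r -> 0 < r ->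
  r - s <= d -> `|p * ln r - q * ln s| <= d * (`|ln r| + 1).
Proof.
move=> pq qs /andP[s0 sr] r0 rs.
have -> : p * ln r - q * ln s = (p - q) * ln r + q * (ln r - ln s) by ring.
rewrite (le_trans (ler_normD _ _)) // [leRHS]mulrDr mulr1 !normrM lerD ?ler_wpM2r //.
have [s1|s1] := eqVneq s 0.
  move: qs; rewrite s1 normr_le0 => /eqP ->; rewrite normr0 mul0r.
  exact: le_trans (normr_ge0 _) pq.
have {}s0 : 0 < s by rewrite lt_def s1.
have lns : 0 <= ln r - ln s by rewrite subr_ge0 ler_ln.
rewrite (ger0_norm lns) (@le_trans _ _ (s * (ln r - ln s))) ?ler_wpM2r //.
rewrite -ln_div ?posrE // (@le_trans _ _ (s * (r / s - 1))) //.
  have /= := @le_ln1Dx _ (r / s - 1).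
  rewrite subrKC ler_pM2l //; apply.
  by rewrite ltrBrDl subrr divr_gt0.
suff -> : s * (r / s - 1) = r - s by [].
by field; rewrite gt_eqF.
Qed.

Lemma ln_powR_le g (r : R) : 0 < g -> 0 < r <= 1 -> `|ln r| <= r `^ (- g) / g.
Proof.
move=> g0 /andP[r0 r1]; rewrite ler0_norm ?ln_le0 // ler_pdivlMr //.
have := ltW (ln_sublinear (@powR_gt0 _ r (- g) r0)).
by rewrite ln_powR mulNr mulrC -mulNr mulrC.
Qed.

(** By [ln_lip] the increment is at most [d (|ln r| + 1)] with [r] the larger
    radius and [d] the distance.  Since [d <= 2 r], the factor [|ln r|], of order
    [r^(g - 1)], is at most a constant times [d^(g - 1)]. *)
Lemma mul_ln_holder (f : R * R -> R) g : 0 < g < 1 ->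
  (forall x y, `|f x - f y| <= enorm (x - y)) -> f 0 = 0 ->
  holder_on unit_ball g (fun x => f x * ln (enorm x)).
Proof.
move=> g01 fl f0; have /andP[g0 g1] := g01.
have fn x : `|f x| <= enorm x by have := fl x 0; rewrite f0 !subr0.
pose C := 2 / (1 - g) + 2; exists C.
suff H x y : unit_ball x -> unit_ball y -> enorm y <= enorm x ->
    `|f x * ln (enorm x) - f y * ln (enorm y)| <= C * enorm (x - y) `^ g.
  move=> x y x1 y1; have [|/ltW] := leP (enorm y) (enorm x); first exact: H.
  by rewrite distrC enormB; exact: H.
rewrite /unit_ball /= => x1 y1 yx.
have [x0|x0] := eqVneq x 0.
  have y0 : y = 0.
    apply/eqP; rewrite -enorm_eq0 eq_le enorm_ge0 andbT (le_trans yx) //.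
    by rewrite le_eqVlt enorm_eq0 x0 eqxx.
  rewrite x0 y0 subrr normr0 mulr_ge0 ?powR_ge0 // addr_ge0 // divr_ge0 //; lra.
have r0 : 0 < enorm x by rewrite enorm_gt0.
have := @ln_lip (f x) (f y) (enorm x) (enorm y) (enorm (x - y)) (fl x y) (fn y).
rewrite enorm_ge0 yx => /(_ isT r0 (le_trans (ler_norm _) (ler_dist_enorm x y))).
move=> /le_trans; apply; set d := enorm (x - y).
have d02 : 0 <= d <= 2 by exact: unit_ball_dist.
have /andP[d0 d2] := d02.
rewrite mulrDr mulr1 mulrDl lerD // ?le_powR_ball //.
have dx : d <= 2 * enorm x.
  rewrite (le_trans (ler_enormD _ _)) //; lra.
have lnr : `|ln (enorm x)| <= enorm x `^ (- (1 - g)) / (1 - g).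
  by apply: ln_powR_le; rewrite ?subr_gt0 // r0 ltW.
rewrite (le_trans (ler_wpM2l d0 lnr)) // mulrA [leRHS]mulrAC ler_pM2r; last first.
  by rewrite invr_gt0 subr_gt0.
have dE : d = d `^ (1 - g) * d `^ g.
  rewrite -powRD ?subrK ?powRr1 //; by rewrite oner_eq0.
rewrite {1}dE mulrAC ler_wpM2r ?powR_ge0 // powRN ler_pdivrMr ?powR_gt0 //.
rewrite (@le_trans _ _ ((2 * enorm x) `^ (1 - g))) //.
  by apply: ge0_ler_powR; rewrite ?nnegrE //; lra.
rewrite powRM ?(ltW r0) // ler_wpM2r ?powR_ge0 //; apply: ler1_powR; lra.
Qed.

Definition x1ln x := x.1 * ln (enorm x).
Definition x2ln x := x.2 * ln (enorm x).

Lemma x1ln_holder g : 0 < g < 1 -> holder_on unit_ball g x1ln.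
Proof.
by move=> g01; apply: mul_ln_holder => // x y; exact: normr1_le_enorm (x - y).
Qed.

Lemma x2ln_holder g : 0 < g < 1 -> holder_on unit_ball g x2ln.
Proof.
by move=> g01; apply: mul_ln_holder => // x y; exact: normr2_le_enorm (x - y).
Qed.

Lemma grad_ln_enorm x : x != 0 ->
  is_grad (fun y => ln (enorm y)) x (x.1 / enorm x ^+ 2) (x.2 / enorm x ^+ 2).
Proof.
move=> x0; have r0 : 0 < enorm x by rewrite enorm_gt0.
have r20 : 0 < x.1 ^+ 2 + x.2 ^+ 2 by rewrite -enorm_sqr exprn_gt0.
have G := gradD (gradM (grad_fst x) (grad_fst x)) (gradM (grad_snd x) (grad_snd x)).
have {}G := gradZ 2^-1 (grad_comp G (is_derive1_ln r20)).
have {}G : is_grad (fun y => 2^-1 * ln (y.1 ^+ 2 + y.2 ^+ 2)) x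
    (x.1 / enorm x ^+ 2) (x.2 / enorm x ^+ 2).
  by apply: is_grad_eq G _ _; rewrite enorm_sqr /=; field; rewrite gt_eqF.
apply: near_grad G; near=> y.
have y0 : 0 < enorm y.
  near: y; apply: (cvgr_gt (enorm x)) => //; exact: enorm_continuous.
by rewrite -enorm_sqr lnXn // mulr2n; field.
Unshelve. all: by end_near. Qed.

Lemma open_unit_ball : open (@unit_ball R).
Proof.
by apply: (@open_comp _ _ (@enorm R) [set t : R | t < 1]);
  [move=> y _; exact: enorm_continuous | exact: open_lt].
Qed.

Lemma unit_ball0 : unit_ball (0 : R * R).
Proof. by rewrite /unit_ball /= /enorm /= expr0n addr0 sqrtr0. Qed.

Lemma x1ln_continuous : continuous x1ln.
Proof.
move=> x; have [->|x0] := eqVneq x 0; last first.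
  exact: is_grad_continuous (gradM (grad_fst x) (grad_ln_enorm x0)).
have g01 : 0 < (2^-1 : R) < 1 by apply/andP; split; lra.
by apply: (holder_on_continuous open_unit_ball unit_ball0 _ (x1ln_holder g01)); lra.
Qed.

Lemma x2ln_continuous : continuous x2ln.
Proof.
move=> x; have [->|x0] := eqVneq x 0; last first.
  exact: is_grad_continuous (gradM (grad_snd x) (grad_ln_enorm x0)).
have g01 : 0 < (2^-1 : R) < 1 by apply/andP; split; lra.
by apply: (holder_on_continuous open_unit_ball unit_ball0 _ (x2ln_holder g01)); lra.
Qed.

End model_functions.

(** * The harmonic function on the slit plane *)

Section slit_plane.
Context {R : realType}.
Implicit Types (x y : R * R) (a b c g r t : R) (f k : R * R -> R).

Lemma grad_atan_div f k x a b c d : k x != 0 -> is_grad f x a b -> is_grad k x c d ->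
  is_grad (fun y => atan (f y / k y)) x
    ((a * k x - f x * c) / (k x ^+ 2 + f x ^+ 2))
    ((b * k x - f x * d) / (k x ^+ 2 + f x ^+ 2)).
Proof.
move=> k0 fx kx.
have k2 : 0 < k x ^+ 2 by rewrite lt_def sqrf_eq0 k0 sqr_ge0.
have kf : k x ^+ 2 + f x ^+ 2 != 0 by rewrite gt_eqF // ltr_pwDl // sqr_ge0.
have qf : 1 + (f x / k x) ^+ 2 != 0 by rewrite gt_eqF // ltr_pwDl // sqr_ge0.
have G := grad_comp (gradM fx (gradV k0 kx)) (is_derive1_atan (f x / k x)).
have E : (1 + (f x / k x) ^+ 2)^-1 = k x ^+ 2 / (k x ^+ 2 + f x ^+ 2).
  apply: (mulfI qf); rewrite divff //; field; by rewrite kf k0.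
by apply: is_grad_eq G _ _; rewrite E; field; rewrite kf k0.
Qed.

(** The complement of the half-axis along which [angle] jumps. *)
Definition slit x := (x.2 != 0) || (x.1 < 0).

Lemma near_slit x : slit x -> \forall y \near x, slit y.
Proof.
case/orP; last first.
  by move=> /near_fst_lt; apply: filterS => y; rewrite /slit => ->; rewrite orbT.
rewrite neq_lt => /orP[/near_snd_lt|/near_snd_gt]; apply: filterS => y y0.
  by rewrite /slit lt_eqF.
by rewrite /slit gt_eqF.
Qed.

Lemma slit_neq0 x : slit x -> x != 0.
Proof. by rewrite /slit; apply: contraTneq => ->; rewrite /= eqxx ltxx. Qed.

Lemma slitP x : x != 0 -> slit x = (angle x < 2 * pi).
Proof.
move=> x0; have pi0 := @pi_gt0 R.
have [x2|x2|x2] := ltgtP x.2 0.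
- rewrite angle_down // /slit lt_eqF //=.
  by have /andP[A B] := atan_bnd (x.1 / x.2); apply/esym; lra.
- rewrite angle_up // /slit gt_eqF //=.
  by have /andP[A B] := atan_bnd (x.1 / x.2); apply/esym; lra.
rewrite /slit x2 eqxx /=; have [x1|x1|x1] := ltgtP x.1 0.
- by rewrite angle_left // x2 mul0r atan0; apply/esym; lra.
- by rewrite angle_Q4 ?x2 // mul0r atan0 addr0 ltxx.
- by move: x0; rewrite (surjective_pairing x) x1 x2 eqxx.
Qed.

(** In each of the three half-planes that cover the slit plane the angle is a
    constant plus or minus the arc tangent of a quotient of coordinates. *)
Lemma grad_angle x : slit x ->
  is_grad angle x (- x.2 / enorm x ^+ 2) (x.1 / enorm x ^+ 2).
Proof.
move=> xs; rewrite enorm_sqr.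
have r20 : x.1 ^+ 2 + x.2 ^+ 2 != 0 by rewrite -enorm_sqr sqrf_eq0 enorm_eq0 slit_neq0.
have up : x.2 != 0 -> forall c, is_grad (fun y => c - atan (y.1 / y.2)) x
    (- x.2 / (x.1 ^+ 2 + x.2 ^+ 2)) (x.1 / (x.1 ^+ 2 + x.2 ^+ 2)).
  move=> x20 c; have G := grad_atan_div x20 (grad_fst x) (grad_snd x).
  apply: is_grad_eq (gradB (grad_cst c x) G) _ _; rewrite (addrC (x.2 ^+ 2)) /=; field.
    by rewrite r20.
  by rewrite r20.
case/orP: xs => [|x10].
  move=> x20; have := up x20; move: x20.
  rewrite neq_lt => /orP[] x20 {}up.
    apply: near_grad (up (3 * pi / 2)).
    by apply: filterS (near_snd_lt x20) => y y0; rewrite angle_down.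
  apply: near_grad (up (pi / 2)).
  by apply: filterS (near_snd_gt x20) => y y0; rewrite angle_up.
have G := grad_atan_div (ltr0_neq0 x10) (grad_snd x) (grad_fst x).
have {}G := gradD (grad_cst pi x) G.
apply: (@near_grad _ (fun y => pi + atan (y.2 / y.1))).
  by apply: filterS (near_fst_lt x10) => y y0; rewrite angle_left.
by apply: is_grad_eq G _ _; field.
Qed.

Lemma hE x : h x = (x.1 ^+ 2 - x.2 ^+ 2) * angle x + 2 * x.1 * x.2 * ln (enorm x).
Proof.
have [->|x0] := eqVneq x 0.
  rewrite /h /h_pol (_ : enorm 0 = 0); last by apply/eqP; rewrite enorm_eq0.
  by rewrite /=; ring.
rewrite /h /h_pol -(sqr_cos2_angle x0) -(sqr_sin2_angle x0); ring.
Qed.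

Lemma grad_h x : slit x -> is_grad h x
  (2 * (x.1 * angle x) + 2 * x2ln x + x.2) (- (2 * (x.2 * angle x)) + 2 * x1ln x + x.1).
Proof.
move=> xs; have x0 := slit_neq0 xs.
have r0 : enorm x != 0 by rewrite enorm_eq0.
have r2 : x.1 ^+ 2 + x.2 ^+ 2 != 0 by rewrite -enorm_sqr sqrf_eq0.
have G1 := gradM (gradB (gradM (grad_fst x) (grad_fst x)) (gradM (grad_snd x) (grad_snd x)))
  (grad_angle xs).
have G2 := gradM (gradM (gradZ 2 (grad_fst x)) (grad_snd x)) (grad_ln_enorm x0).
apply: (@near_grad _ (fun y => (y.1 * y.1 - y.2 * y.2) * angle y +
   2 * y.1 * y.2 * ln (enorm y))).
  by near=> y; rewrite hE !expr2.
by apply: is_grad_eq (gradD G1 G2) _ _; rewrite /x1ln /x2ln enorm_sqr; field.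
Unshelve. all: by end_near. Qed.

Lemma h_harmonic x : slit x -> has_laplacian h x 0.
Proof.
move=> xs; have x0 := slit_neq0 xs.
have r2 : x.1 ^+ 2 + x.2 ^+ 2 != 0 by rewrite -enorm_sqr sqrf_eq0 enorm_eq0.
have A := grad_angle xs; have L := grad_ln_enorm x0.
apply: (has_laplacianI (A := fun y => 2 * (y.1 * angle y) + 2 * x2ln y + y.2)
  (B := fun y => - (2 * (y.2 * angle y)) + 2 * x1ln y + y.1)).
- by apply: filterS (near_slit xs) => y; exact: grad_h.
- exact: (gradD (gradD (gradZ 2 (gradM (grad_fst x) A))
    (gradZ 2 (gradM (grad_snd x) L))) (grad_snd x)).
- exact: (gradD (gradD (gradN (gradZ 2 (gradM (grad_snd x) A)))
    (gradZ 2 (gradM (grad_fst x) L))) (grad_fst x)).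
- by rewrite enorm_sqr; field.
Qed.

Lemma sector_slit a b : b <= 2 * pi -> sector a b `<=` [set x | slit x].
Proof.
by move=> b2 x [x0 /andP[_ xb]] /=; rewrite slitP //; exact: lt_le_trans b2.
Qed.

(** The hypothesis [b - a < 2 pi] is what makes [polar_lip] applicable. *)
Lemma mul_angle_lip f a b : 0 <= a -> a < b -> b <= 2 * pi -> b - a < 2 * pi ->
  (forall x y, `|f x - f y| <= enorm (x - y)) -> f 0 = 0 ->
  lip_on (sector a b) (fun x => f x * angle x).
Proof.
move=> a0 ab b2 ba fl f0; have pi0 := @pi_gt0 R.
have [|C C0 CP] := @polar_lip R (b - a); first by apply/andP; split; lra.
exists (C + 2 * pi) => x y [x0 /andP[ax xb]] [y0 /andP[ay yb]].
have dM : `|angle x - angle y| <= b - a by rewrite ler_norml; apply/andP; split; lra.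
have := CP _ _ _ _ (enorm_ge0 x) (enorm_ge0 y) dM.
rewrite -!angleK // => dC.
have -> : f x * angle x - f y * angle y =
  f y * (angle x - angle y) + (f x - f y) * angle x by ring.
rewrite (le_trans (ler_normD _ _)) // !normrM [leRHS]mulrDl lerD //.
  rewrite (le_trans _ dC) // ler_wpM2r //.
  by have := fl y 0; rewrite f0 !subr0.
rewrite mulrC ler_pM //; rewrite ger0_norm; lra.
Qed.

Lemma h_holder a b g : 0 <= a -> a < b -> b <= 2 * pi -> b - a < 2 * pi ->
  0 < g < 1 -> C1holder (unit_ball `&` sector a b) g h.
Proof.
move=> a0 ab b2 ba g01.
have sub1 : (@unit_ball R `&` sector a b) `<=` unit_ball by move=> ? [].
have sub2 : (@unit_ball R `&` sector a b) `<=` sector a b by move=> ? [].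
have lip_h f : lip_on (sector a b) f -> holder_on (unit_ball `&` sector a b) g f.
  by move=> fl; apply: lip_holder_ball => //; exact: lip_on_subset fl.
have A1 : lip_on (sector a b) (fun x => x.1 * angle x).
  by apply: mul_angle_lip => // x y; exact: normr1_le_enorm (x - y).
have A2 : lip_on (sector a b) (fun x => x.2 * angle x).
  by apply: mul_angle_lip => // x y; exact: normr2_le_enorm (x - y).
apply: C1holderI.
- by move=> x [_ /(sector_slit b2)/grad_h]; exact.
- apply: holder_onD; last exact/lip_h/lip_on_snd.
  apply: holder_onD; first exact/holder_onZ/lip_h.
  exact/holder_onZ/(holder_on_subset sub1)/x2ln_holder.
- apply: holder_onD; last exact/lip_h/lip_on_fst.
  apply: holder_onD; last exact/holder_onZ/(holder_on_subset sub1)/x1ln_holder.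
  have := holder_onZ (-1) (holder_onZ 2 (lip_h _ A2)).
  by move=> [C CP]; exists C => x y Ax Ay; have := CP x y Ax Ay; rewrite !mulN1r.
Qed.

Lemma near0_ray (V : set (R * R)) t : open V -> V 0 ->
  exists2 d : R, 0 < d & forall r, 0 < r < d -> V (polar r t).
Proof.
rewrite openE => Vo /Vo /nbhs_ballP[d /= d0 dV]; exists d => // r /andP[r0 rd].
apply: dV; split; rewrite /ball /= sub0r normrN normrM (gtr0_norm r0).
  by rewrite (le_lt_trans _ rd) // ler_piMr ?(ltW r0) // cos_max.
by rewrite (le_lt_trans _ rd) // ler_piMr ?(ltW r0) // sin_max.
Qed.

(** Comparing [r] with [r / 2] gives a difference quotient of order [ln r]. *)
Lemma rlnr_not_lip (C d : R) : 0 < d -> ~ (forall r s, 0 < r < d -> 0 < s < d ->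
  `|r * (2 * ln r + 1) - s * (2 * ln s + 1)| <= C * `|r - s|).
Proof.
(* The exponent makes [ln r + ln 2 + 1 / 2] smaller than [- |C|]. *)
move=> d0 H; pose r := Num.min (d / 2) (expR (- (`|C| + 3))).
have r0 : 0 < r by rewrite lt_min divr_gt0 //= expR_gt0.
have rd : r < d by rewrite gt_min; apply/orP; left; lra.
have := H r (r / 2); rewrite r0 rd => /(_ isT ltac:(apply/andP; split; lra)).
have lnr : ln r <= - (`|C| + 3).
  by rewrite -[leRHS]expRK ler_ln ?posrE ?expR_gt0 // ge_min lexx orbT.
have /andP[ln2 ln2'] : (0 < ln (2 : R)) && (ln (2 : R) < 2).
  by apply/andP; split; [apply: ln_gt0; lra | apply: ln_sublinear; lra].
rewrite ln_div ?posrE //.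
have -> : r * (2 * ln r + 1) - r / 2 * (2 * (ln r - ln 2) + 1) =
  r * (ln r + ln 2 + 2^-1) by field.
have -> : r - r / 2 = r * 2^-1 by field.
rewrite !normrM (gtr0_norm r0) mulrCA ler_pM2l // (gtr0_norm (_ : 0 < 2^-1)) ?invr_gt0 //.
have C1 := ler_norm C; have C2 := normr_ge0 C.
rewrite ltr0_norm; last by lra.
by lra.
Qed.

Lemma enorm_ray r s t : enorm (polar r t - polar s t) = `|r - s|.
Proof.
rewrite /enorm /= -!mulrBl !exprMn -mulrDr cos2Dsin2 mulr1; exact: sqrtr_sqr.
Qed.

(** Along the ray of angle [t] the combination
    [sin t * 'D_e1 h + cos t * 'D_e2 h] equals [r (2 ln r + 1)] whatever [t]
    is, because the terms with the angle cancel. *)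
Lemma h_notC11 a b (V : set (R * R)) : 0 <= a -> a < b -> b <= 2 * pi ->
  open V -> V 0 -> ~ C1holder (V `&` sector a b) 1 h.
Proof.
move=> a0 ab b2 Vo V0 [_ [C CP]]; pose t := (a + b) / 2.
have [d d0 dV] := near0_ray t Vo V0.
have t02 : 0 < t <= 2 * pi by rewrite /t; apply/andP; split; lra.
apply: (@rlnr_not_lip (2 * `|C|) d d0) => r s rd sd.
have inS p : 0 < p < d -> (V `&` sector a b) (polar p t).
  move=> pd; have /andP[p0 _] := pd; have [nE aE] := polarK p0 t02; split; first exact: dV.
  split; first by rewrite -enorm_eq0 nE gt_eqF.
  by rewrite aE /t; apply/andP; split; lra.
have D p : 0 < p < d ->
    p * (2 * ln p + 1) = sin t * 'D_e1 h (polar p t) + cos t * 'D_e2 h (polar p t).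
  move=> pd; have /andP[p0 _] := pd; have [nE aE] := polarK p0 t02.
  have [_ -> ->] := is_gradE (grad_h (sector_slit b2 (inS p pd).2)).
  rewrite /x1ln /x2ln nE aE /polar /=.
  transitivity (p * (2 * ln p + 1) * (cos t ^+ 2 + sin t ^+ 2)); last by ring.
  by rewrite cos2Dsin2 mulr1.
rewrite (D r rd) (D s sd).
have [] := CP _ _ (inS r rd) (inS s sd); rewrite powRr1 ?enorm_ge0 // enorm_ray.
move: ('D_e1 h (polar r t)) ('D_e1 h (polar s t)) ('D_e2 h (polar r t))
  ('D_e2 h (polar s t)) => A1 A2 B1 B2 HA HB.
have -> : sin t * A1 + cos t * B1 - (sin t * A2 + cos t * B2) =
  sin t * (A1 - A2) + cos t * (B1 - B2) by ring.
rewrite (le_trans (ler_normD _ _)) // !normrM.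
have -> : 2 * `|C| * `|r - s| = `|C| * `|r - s| + `|C| * `|r - s| by ring.
have le1 (p q : R) : `|p| <= 1 -> `|q| <= C * `|r - s| -> `|p| * `|q| <= `|C| * `|r - s|.
  move=> p1 qC; rewrite (le_trans (ler_piMl _ p1)) // (le_trans qC) //.
  by rewrite ler_wpM2r // ler_norm.
by rewrite lerD // le1 ?sin_max ?cos_max.
Qed.

End slit_plane.

(** * Closed forms and gradients of the explicit solution *)

Section explicit_solution.
Context {R : realType}.
Implicit Types (x y : R * R) (a b c g r s t : R).

Lemma is_derive_mul_norm s : is_derive s 1 (fun t : R => t * `|t|) (2 * `|s|).
Proof.
have [s0|s0|->] := ltgtP s 0.
- apply: (@near_eq_is_derive _ _ _ (fun t : R => - (t * t))).
    by near=> t; rewrite ltr0_norm ?mulrN //; near: t; exact: lt_nbhsl.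
  by apply: is_derive_eq; rewrite ltr0_norm // /GRing.scale /=; ring.
- apply: (@near_eq_is_derive _ _ _ (fun t : R => t * t)).
    by near=> t; rewrite gtr0_norm //; near: t; exact: lt_nbhsr.
  by apply: is_derive_eq; rewrite gtr0_norm // /GRing.scale /=; ring.
rewrite normr0 mulr0.
have : is_diff 0 (fun t : R => t * `|t|) 0.
  apply: is_diff_littleo; first by rewrite mul0r.
  move=> e e0; have /cvgrPdist_le /(_ _ e0) := @cvg_id _ (nbhs (0 : R)).
  apply: filterS => t; rewrite sub0r normrN subr0 normrM normr_id => te.
  by rewrite ler_wpM2r.
move=> [df dE]; apply: DeriveDef; first exact/derivable1_diffP.
by rewrite deriveE // dE.
Unshelve. all: by end_near. Qed.

Lemma wE x : w x = - (x.1 * `|x.1| + x.2 * `|x.2|) / 4.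
Proof.
rewrite /w; have [x1|x1|x1] := ltgtP x.1 0; have [x2|x2|x2] := ltgtP x.2 0 => /=;
rewrite ?x1 ?x2 ?(ltr0_norm x1) ?(ltr0_norm x2) ?(gtr0_norm x1) ?(gtr0_norm x2) ?normr0;
by field.
Qed.

Lemma grad_w x : is_grad w x (- `|x.1| / 2) (- `|x.2| / 2).
Proof.
have G := gradZ (- 4^-1) (gradD (grad_comp (grad_fst x) (is_derive_mul_norm _))
  (grad_comp (grad_snd x) (is_derive_mul_norm _))).
by apply: (eq_grad G) => [y||]; rewrite ?wE /=; field.
Qed.

Lemma lip_grad_w1 : lip_on setT (fun x : R * R => - `|x.1| / 2).
Proof.
rewrite (_ : (fun _ => _) = fun x : R * R => - 2^-1 * `|x.1|).
  exact/lip_onZ/lip_on_norm/lip_on_fst.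
by apply/funext => x; field.
Qed.

Lemma lip_grad_w2 : lip_on setT (fun x : R * R => - `|x.2| / 2).
Proof.
rewrite (_ : (fun _ => _) = fun x : R * R => - 2^-1 * `|x.2|).
  exact/lip_onZ/lip_on_norm/lip_on_snd.
by apply/funext => x; field.
Qed.

Lemma w_C11 : C1holder setT 1 (@w R).
Proof.
apply: C1holderI => [x _||]; first exact: grad_w.
  exact/lip_holder1/lip_grad_w1.
exact/lip_holder1/lip_grad_w2.
Qed.

Lemma w_C1 : C1 (@w R).
Proof.
by apply: C1I grad_w _ _; apply: lip_on_continuous;
  [exact: lip_grad_w1 | exact: lip_grad_w2].
Qed.

(** Symmetric in the two coordinates, so that one computation gives both partial
    derivatives. *)
Definition logpart x : R := x.1 ^+ 2 * atan (x.2 / x.1) + x.2 ^+ 2 * atan (x.1 / x.2)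
  + 2 * x.1 * x.2 * ln (enorm x).

(** The mean of [u1] and [u2]; it carries the whole singularity at the origin. *)
Definition umean x : R := - x.1 ^+ 2 / 8 - logpart x / (4 * pi).

Lemma normr_fst x : `|x.1| <= `|x|.
Proof. by rewrite [leRHS]prod_normE le_max lexx. Qed.

(** On the line [x1 = 0] the function is bounded by [2 x1^2], so the gradient is
    0, which is also what the formula gives since [0 / 0 = 0]. *)
Lemma grad_sqr_atan x : is_grad (fun y => y.1 ^+ 2 * atan (y.2 / y.1)) x
  (2 * homat x.1 x.2 - x.1 ^+ 2 * x.2 / enorm x ^+ 2) (x.1 ^+ 3 / enorm x ^+ 2).
Proof.
have [x0|x0] := eqVneq x.1 0.
  rewrite x0 /homat !mul0r mulr0 !expr0n /= !mul0r subr0.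
  apply: grad0_littleo; first by rewrite x0 expr0n mul0r.
  move=> e e0; have e20 : 0 < e / 2 by rewrite divr_gt0.
  near=> y.
  have y1 : `|y.1| <= `|y - x| by have := normr_fst (y - x); rewrite /= x0 subr0.
  have y1e : `|y.1| <= e / 2.
    rewrite ler_norml; apply/andP; split; apply: ltW; near: y.
      by apply: near_fst_gt; rewrite x0 oppr_lt0.
    by apply: near_fst_lt; rewrite x0.
  have a2 : `|atan (y.2 / y.1)| <= 2.
    by rewrite (le_trans (ltW (norm_atan_lt _))) // ltW // pihalf_lt2.
  have -> : e * `|y - x| = (e / 2 * `|y - x|) * 2 by field.
  by rewrite expr2 !normrM ler_pM // ler_pM.
have r2 : x.1 ^+ 2 + x.2 ^+ 2 != 0.
  by rewrite -enorm_sqr sqrf_eq0 enorm_eq0; apply: contraNneq x0 => ->.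
have G := gradM (gradM (grad_fst x) (grad_fst x)) (grad_atan_div x0 (grad_snd x) (grad_fst x)).
apply: is_grad_eq G _ _; rewrite enorm_sqr /homat; field; by rewrite r2.
Unshelve. all: by end_near. Qed.

Lemma grad_mul_ln x : is_grad (fun y => y.1 * y.2 * ln (enorm y)) x
  (x2ln x + x.1 ^+ 2 * x.2 / enorm x ^+ 2) (x1ln x + x.1 * x.2 ^+ 2 / enorm x ^+ 2).
Proof.
have [->|x0] := eqVneq x 0; last first.
  have r0 : enorm x != 0 by rewrite enorm_eq0.
  have G := gradM (gradM (grad_fst x) (grad_snd x)) (grad_ln_enorm x0).
  by apply: is_grad_eq G _ _; rewrite /x1ln /x2ln; field.
rewrite /x2ln /x1ln /= expr0n !mul0r addr0; apply: grad0_littleo.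
  by rewrite !mul0r.
move=> e e0; near=> y; rewrite subr0 -mulrA normrM mulrC ler_pM //; last exact: normr_fst.
rewrite -/(x2ln y) -normrN -sub0r; near: y.
have /cvgrPdist_le /(_ _ e0) := @x2ln_continuous R 0.
by apply: filterS => y; rewrite {1}/x2ln mul0r.
Unshelve. all: by end_near. Qed.

Lemma grad_logpart x : is_grad logpart x
  (2 * homat x.1 x.2 + 2 * x2ln x + x.2) (2 * homat x.2 x.1 + 2 * x1ln x + x.1).
Proof.
have S := @grad_swap R (fun y => y.1 ^+ 2 * atan (y.2 / y.1)) x _ _ (grad_sqr_atan (x.2, x.1)).
have G := gradD (gradD (grad_sqr_atan x) S) (gradZ 2 (grad_mul_ln x)).
apply: (eq_grad G).
- by move=> y; rewrite /logpart /= !mulrA.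
- have [->|x0] := eqVneq x 0.
    by rewrite enorm_swap /homat /x2ln /= expr0n /=; ring.
  have r2 : x.1 ^+ 2 + x.2 ^+ 2 != 0 by rewrite -enorm_sqr sqrf_eq0 enorm_eq0.
  by rewrite /= enorm_swap enorm_sqr; field.
- have [->|x0] := eqVneq x 0.
    by rewrite enorm_swap /homat /x1ln /= expr0n /=; ring.
  have r2 : x.1 ^+ 2 + x.2 ^+ 2 != 0 by rewrite -enorm_sqr sqrf_eq0 enorm_eq0.
  by rewrite /= enorm_swap enorm_sqr; field.
Qed.

Definition umean1 x : R :=
  - 4^-1 * x.1 + - (4 * pi)^-1 * (2 * homat x.1 x.2 + 2 * x2ln x + x.2).
Definition umean2 x : R := - (4 * pi)^-1 * (2 * homat x.2 x.1 + 2 * x1ln x + x.1).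

Lemma grad_umean x : is_grad umean x (umean1 x) (umean2 x).
Proof.
have G := gradD (gradZ (- 8^-1) (gradM (grad_fst x) (grad_fst x)))
  (gradZ (- (4 * pi)^-1) (grad_logpart x)).
apply: (eq_grad G).
- by move=> y; rewrite /umean mulrC (mulrC (logpart y)) !mulNr mulrN.
- by rewrite /umean1; congr (_ + _); field.
- by rewrite /umean2 !mulr0 !mul0r !addr0 mulr0 add0r.
Qed.

Lemma homat2_lip : lip_on setT (fun x : R * R => homat x.2 x.1).
Proof. exact: (lip_on_swap (@homat_lip R)). Qed.

Lemma umean1_holder g : 0 < g < 1 -> holder_on unit_ball g umean1.
Proof.
move=> g01; have lipb f : lip_on setT f -> holder_on unit_ball g f.
  by move=> fl; apply: lip_holder_ball => //; exact: lip_on_subset fl.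
apply: holder_onD; first exact/holder_onZ/lipb/lip_on_fst.
apply: holder_onZ; apply: holder_onD; last exact/lipb/lip_on_snd.
apply: holder_onD; first exact/holder_onZ/lipb/homat_lip.
exact/holder_onZ/x2ln_holder.
Qed.

Lemma umean2_holder g : 0 < g < 1 -> holder_on unit_ball g umean2.
Proof.
move=> g01; have lipb f : lip_on setT f -> holder_on unit_ball g f.
  by move=> fl; apply: lip_holder_ball => //; exact: lip_on_subset fl.
apply: holder_onZ; apply: holder_onD; last exact/lipb/lip_on_fst.
apply: holder_onD; first exact/holder_onZ/lipb/homat2_lip.
exact/holder_onZ/x1ln_holder.
Qed.

Lemma umean1_continuous : continuous umean1.
Proof.
apply: continuous_add; first exact/continuous_mul_cst/lip_on_continuous/lip_on_fst.
apply: continuous_mul_cst; apply: continuous_add; last exact/lip_on_continuous/lip_on_snd.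
apply: continuous_add; apply: continuous_mul_cst.
  exact/lip_on_continuous/homat_lip.
exact: x2ln_continuous.
Qed.

Lemma umean2_continuous : continuous umean2.
Proof.
apply: continuous_mul_cst; apply: continuous_add; last exact/lip_on_continuous/lip_on_fst.
apply: continuous_add; apply: continuous_mul_cst.
  exact/lip_on_continuous/homat2_lip.
exact: x1ln_continuous.
Qed.

Lemma umeanN x : umean (- x) = umean x.
Proof. by rewrite /umean /logpart enormN /= !invrN !mulrNN !sqrrN !mulrN !mulNr opprK. Qed.

Lemma wN x : w (- x) = - w x.
Proof. by rewrite !wE /= !normrN; field. Qed.

Lemma sqr_normE a : a ^+ 2 = `|a| ^+ 2.
Proof. by rewrite real_normK ?num_real. Qed.

Lemma u1hE x : u1 x = (if (0 <= x.1) && (0 < x.2) then - (x.1 ^+ 2 + x.2 ^+ 2) / 4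
  else (x.1 ^+ 2 - x.2 ^+ 2) / 4) - h x / (4 * pi).
Proof.
have [->|x0] := eqVneq x 0.
  rewrite /u1 /u1_pol /h (_ : enorm 0 = 0); last by apply/eqP; rewrite enorm_eq0.
  by rewrite /= ltxx andbF expr0n /= !mul0r subrr mul0r oppr0; case: ifP.
rewrite /u1 /u1_pol angle_le_pihalf // -/(h x); case: ifP => _; congr (_ - _).
  by rewrite enorm_sqr mulNr.
by rewrite sqr_cos2_angle.
Qed.

(** In each open quadrant [angle] and [atan (x1 / x2)] are a constant plus or
    minus [atan (x2 / x1)]; the constants account for the sign changes of [w]. *)
Lemma u1E x : u1 x = umean x + w x / 2.
Proof.
have pi0 : pi != 0 :> R by rewrite gt_eqF // pi_gt0.
rewrite u1hE hE wE /umean /logpart.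
have [x1|x1|x1] := ltgtP x.1 0; have [x2|x2|x2] := ltgtP x.2 0 => /=.
- rewrite angle_left // (ltr0_norm x1) (ltr0_norm x2) (atanVN x1 x2).
  by move: (pi : R) pi0 => P P0; field.
- rewrite angle_left // (ltr0_norm x1) (gtr0_norm x2).
  rewrite (@atanV_lt0 R x.1 x.2) ?nmulr_rlt0 //.
  by move: (pi : R) pi0 => P P0; field.
- rewrite angle_left // (ltr0_norm x1) x2 !(normr0, invr0, mulr0, mul0r, atan0).
  by move: (pi : R) pi0 => P P0; field.
- rewrite angle_Q4 ?ltW // (gtr0_norm x1) (ltr0_norm x2).
  rewrite (@atanV_lt0 R x.1 x.2) ?pmulr_rlt0 //.
  by move: (pi : R) pi0 => P P0; field.
- rewrite angle_Q1 // (gtr0_norm x1) (gtr0_norm x2) (atanV x1 x2).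
  by move: (pi : R) pi0 => P P0; field.
- rewrite angle_Q4 ?x2 // (gtr0_norm x1) !(normr0, invr0, mulr0, mul0r, atan0).
  by move: (pi : R) pi0 => P P0; field.
- rewrite angle_down // x1 (ltr0_norm x2) !(normr0, invr0, mulr0, mul0r, atan0).
  by move: (pi : R) pi0 => P P0; field.
- rewrite angle_up // x1 (gtr0_norm x2) !(normr0, invr0, mulr0, mul0r, atan0).
  by move: (pi : R) pi0 => P P0; field.
- rewrite x1 x2 !(normr0, invr0, mulr0, mul0r, atan0).
  by move: (pi : R) pi0 => P P0; field.
Qed.

End explicit_solution.

(** * Regularity and Laplacians of the explicit solution *)

Section system_solution.
Context {R : realType}.
Implicit Types (x y : R * R) (a b c g r s t : R) (f k : R * R -> R) (A : set (R * R)).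

Lemma u2E x : u2 x = u1 x - w x.
Proof.
have [->|x0] := eqVneq x 0.
  have e0 : enorm (0 : R * R) = 0 by apply/eqP; rewrite enorm_eq0.
  rewrite u1E wE /umean /logpart /= !mul0r addr0 /u2 /u2_pol /h_pol e0 expr0n /= !mul0r.
  by case: ifP => _; [|case: ifP => _]; ring.
rewrite u1hE wE /u2 /u2_pol -/(h x) sqr_cos2_angle // enorm_sqr.
move: (h x / (4 * pi)) => H; case: ifPn.
  rewrite angle_le_pi // => /orP[x2|/andP[/eqP x2 x1]].
    rewrite x2 andbT (gtr0_norm x2); case: leP => x1.
      by rewrite ger0_norm //; field.
    by rewrite ltr0_norm //; field.
  by rewrite x2 ltxx andbF ltr0_norm // normr0; field.
move=> tpi; rewrite angle_le_3pihalf // ?(negbTE tpi) //.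
move: tpi; rewrite angle_le_pi // negb_or -leNgt => /andP[x2 x12].
rewrite ltNge x2 andbF /= (ler0_norm x2).
case: leP => x1; last by rewrite gtr0_norm //; field.
by rewrite ler0_norm //; field.
Qed.

Lemma u2N x : u2 x = u1 (- x).
Proof. by rewrite u2E !u1E umeanN wN; field. Qed.

Lemma grad_u1 x : is_grad u1 x
  (umean1 x + 2^-1 * (- `|x.1| / 2)) (umean2 x + 2^-1 * (- `|x.2| / 2)).
Proof.
have G := gradD (grad_umean x) (gradZ 2^-1 (grad_w x)).
by apply: (eq_grad G) => [y||] //; rewrite u1E mulrC.
Qed.

Lemma u1_holder g : 0 < g < 1 -> C1holder unit_ball g (@u1 R).
Proof.
move=> g01; have lipb f : lip_on setT f -> holder_on unit_ball g f.
  by move=> fl; apply: lip_holder_ball => //; exact: lip_on_subset fl.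
apply: C1holderI => [x _||]; first exact: grad_u1.
  apply: holder_onD; first exact: umean1_holder.
  exact/holder_onZ/lipb/lip_grad_w1.
apply: holder_onD; first exact: umean2_holder.
exact/holder_onZ/lipb/lip_grad_w2.
Qed.

Lemma u1_C1 : C1 (@u1 R).
Proof.
apply: C1I => [x||]; first exact: grad_u1.
  apply: continuous_add; first exact: umean1_continuous.
  exact/continuous_mul_cst/lip_on_continuous/lip_grad_w1.
apply: continuous_add; first exact: umean2_continuous.
exact/continuous_mul_cst/lip_on_continuous/lip_grad_w2.
Qed.

Lemma u2_C1 : C1 (@u2 R).
Proof.
rewrite (_ : u2 = fun x => u1 x - w x); last by apply/funext => x; rewrite u2E.
by apply: C1B; [exact: u1_C1 | exact: w_C1].
Qed.

Lemma u1_lap_Q1 x : 0 < x.1 -> 0 < x.2 -> has_laplacian u1 x (- 1).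
Proof.
move=> x1 x2; have xs : slit x by rewrite /slit gt_eqF.
have := has_laplacianD (has_laplacian_quadratic (- 4^-1) (- 4^-1) x)
  (has_laplacianZ (- (4 * pi)^-1) (h_harmonic xs)).
rewrite mulr0 addr0 (_ : 2 * - 4^-1 + 2 * - 4^-1 = - 1); last by field.
apply: near_laplacian; have n1 := near_fst_gt x1; have n2 := near_snd_gt x2.
near=> y; have y1 : 0 < y.1 by near: y.
have y2 : 0 < y.2 by near: y.
by rewrite u1hE (ltW y1) y2 /=; move: (4 * pi)^-1 => c; field.
Unshelve. all: by end_near. Qed.

Lemma near_off_Q1 x : (x.1 < 0) || (x.2 < 0) ->
  \forall y \near x, (y.1 < 0) || (y.2 < 0).
Proof.
by case/orP => [/near_fst_lt|/near_snd_lt]; apply: filterS => y ->; rewrite ?orbT.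
Qed.

Lemma u1_lap_off_Q1 x : (x.1 < 0) || (x.2 < 0) -> has_laplacian u1 x 0.
Proof.
move=> x12; have xs : slit x.
  by rewrite /slit; case/orP: x12 => [->|/lt_eqF ->] //; rewrite orbT.
have := has_laplacianD (has_laplacian_quadratic 4^-1 (- 4^-1) x)
  (has_laplacianZ (- (4 * pi)^-1) (h_harmonic xs)).
rewrite mulr0 addr0 (_ : 2 * 4^-1 + 2 * - 4^-1 = 0); last by field.
apply: near_laplacian; apply: filterS (near_off_Q1 x12) => y y12.
have -> : u1 y = (y.1 ^+ 2 - y.2 ^+ 2) / 4 - h y / (4 * pi).
  by rewrite u1hE; case/orP: y12 => y0;
    [rewrite leNgt y0 | rewrite [0 < y.2]ltNge (ltW y0) andbF].
by move: (4 * pi)^-1 => c; field.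
Qed.

(** The reflection [u2 x = u1 (- x)] preserves Laplacians. *)
Lemma u2_laplacian x l : has_laplacian u1 (- x) l -> has_laplacian u2 x l.
Proof.
move=> /has_laplacian_compN; apply: near_laplacian.
by near=> y; rewrite u2N.
Unshelve. all: by end_near. Qed.

Lemma is_derive_norm s : s != 0 -> is_derive s 1 (fun t : R => `|t|) (Num.sg s).
Proof.
rewrite neq_lt => /orP[s0|s0].
  apply: (@near_eq_is_derive _ _ _ (fun t : R => - t)).
    by near=> t; rewrite ltr0_norm ?mulrN //; near: t; exact: lt_nbhsl.
  by rewrite ltr0_sg //; exact: is_deriveNid.
apply: (@near_eq_is_derive _ _ _ (fun t : R => t)).
  by near=> t; rewrite gtr0_norm //; near: t; exact: lt_nbhsr.
by rewrite gtr0_sg //; exact: is_derive_id.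
Unshelve. all: by end_near. Qed.

Lemma w_laplacian x : x.1 != 0 -> x.2 != 0 ->
  has_laplacian w x (- (Num.sg x.1 + Num.sg x.2) / 2).
Proof.
move=> x1 x2.
have G1 := gradZ (- 2^-1) (grad_comp (grad_fst x) (is_derive_norm x1)).
have G2 := gradZ (- 2^-1) (grad_comp (grad_snd x) (is_derive_norm x2)).
apply: (has_laplacianI _ G1 G2); last by field.
by near=> y; apply: (is_grad_eq (grad_w y)); field.
Unshelve. all: by end_near. Qed.

Lemma sector_Q1 x : sector 0 (pi / 2) x -> 0 < x.1 /\ 0 < x.2.
Proof.
move=> [x0 /andP[_ t2]]; have := ltW t2; rewrite angle_le_pihalf // => /andP[x1 x2].
split=> //; rewrite lt_def x1 andbT; apply: contraTneq t2 => x10.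
by rewrite angle_up // x10 mul0r atan0 subr0 ltxx.
Qed.

Lemma enorm_sqr_C11 A : C1holder A 1 (fun x => x.1 ^+ 2 + x.2 ^+ 2).
Proof.
apply: (@C1holderI _ A 1 _ (fun x => 2 * x.1) (fun x => 2 * x.2)).
- move=> x _.
  have G := gradD (gradM (grad_fst x) (grad_fst x)) (gradM (grad_snd x) (grad_snd x)).
  by apply: (eq_grad G) => [y||] //=; ring.
- exact/lip_holder1/lip_onZ/lip_on_fst.
- exact/lip_holder1/lip_onZ/lip_on_snd.
Qed.

(** In the open first quadrant [h] is a combination of [u1] and a quadratic
    polynomial, so a Lipschitz gradient of [u1] would give one of [h]. *)
Lemma u1_notC11 : ~ C11_near (@u1 R) 0.
Proof.
have pi0 := @pi_gt0 R; move=> [V [Vo V0 uV]].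
have a0 : (0 : R) <= 0 by []. have ab : (0 : R) < pi / 2 by lra.
have b2 : pi / 2 <= 2 * pi :> R by lra.
apply: (h_notC11 a0 ab b2 Vo V0).
have sub : V `&` sector 0 (pi / 2) `<=` V by move=> ? [].
have := C1holderZ (- (4 * pi)) (C1holderD (C1holder_subset sub uV)
  (C1holderZ 4^-1 (enorm_sqr_C11 _))).
apply: C1holder_near => x [_ /sector_Q1[x1 x2]].
have n1 := near_fst_gt x1; have n2 := near_snd_gt x2.
near=> y; have y1 : 0 < y.1 by near: y.
have y2 : 0 < y.2 by near: y.
rewrite u1hE (ltW y1) y2 /=; move: (pi : R) pi0 => P P0.
by field; rewrite gt_eqF.
Unshelve. all: by end_near. Qed.

Lemma u2_notC11 : ~ C11_near (@u2 R) 0.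
Proof.
move=> [V [Vo V0 uV]]; apply: u1_notC11; exists V; split=> //.
have := C1holderD uV (C1holder_subset (@subsetT _ V) w_C11).
by apply: C1holder_near => x _; near=> y; rewrite u2E subrK.
Unshelve. all: by end_near. Qed.

(** For [pi / 2 < t < 2 pi] one coordinate is negative: otherwise the point would
    lie on the cut or have an angle at most [pi / 2]. *)
Lemma u1_lap_polar r t : 0 < r -> 0 < t < 2 * pi -> t != pi / 2 ->
  has_laplacian u1 (polar r t) (- ((t <= pi / 2)%R%:R)).
Proof.
move=> r0 /andP[t0 t2] tpi; have [nE aE] := polarK r0 (introT andP (conj t0 (ltW t2))).
have x0 : polar r t != 0 by rewrite -enorm_eq0 nE gt_eqF.
move: (polar r t) nE aE x0 => x nE aE x0.
have := angle_le_pihalf x0; rewrite aE => tE.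
have [tle|tgt] := boolP (t <= pi / 2).
  have [] := @sector_Q1 x; last exact: u1_lap_Q1.
  by split=> //; rewrite aE t0 lt_neqAle tpi.
rewrite oppr0; apply: u1_lap_off_Q1.
rewrite (negbTE tgt) in tE; apply/orP; have [|x1] := ltP x.1 0; first by left.
right; move: tE; rewrite x1 /= => /esym/negbT; rewrite -leNgt le_eqVlt => /orP[/eqP x2|//].
have x1' : 0 < x.1.
  rewrite lt_def x1 andbT; apply: contraNneq x0 => x1'.
  by rewrite (surjective_pairing x) x1' x2.
have x2' : x.2 <= 0 by rewrite x2.
have := angle_Q4 x1' x2'; rewrite aE x2 mul0r atan0 addr0 => t2E.
by rewrite t2E ltxx in t2.
Qed.

End system_solution.

(** * Behaviour along rays *)

Section radial.
Context {R : realType}.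
Implicit Types (a b c r s t M : R).

Lemma near_ln_le M : \forall r \near 0^'+, ln r <= M.
Proof.
near=> r; have r0 : 0 < r by near: r; exact: nbhs_right_gt.
rewrite -(expRK M) ler_ln ?posrE ?expR_gt0 //.
by near: r; apply: nbhs_right_le; exact: expR_gt0.
Unshelve. all: by end_near. Qed.

(** On a ray, [u1] is [r^2] times an affine function of [ln r]. *)
Definition ray_coef t : R :=
  (if t <= pi / 2 then - 4^-1 else cos (2 * t) / 4) - t * cos (2 * t) / (4 * pi).

Definition ray_lncoef t : R := - sin (2 * t) / (4 * pi).

Lemma u1_ray r t : 0 < r -> 0 < t <= 2 * pi ->
  u1 (polar r t) = r ^+ 2 * (ray_coef t + ray_lncoef t * ln r).
Proof.
move=> r0 t0; rewrite /u1; have [-> ->] := polarK r0 t0.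
rewrite /u1_pol /ray_coef /ray_lncoef /h_pol.
by case: ifP => _; move: (4 * pi)^-1 => c; field.
Qed.

Lemma u1_ray_gt0 t : 0 < t <= 2 * pi -> ray_lncoef t < 0 ->
  \forall r \near 0^'+, 0 < u1 (polar r t).
Proof.
move=> t0 B0; near=> r; have r0 : 0 < r by near: r; exact: nbhs_right_gt.
rewrite u1_ray // pmulr_rgt0 ?exprn_gt0 // -ltrBlDl sub0r.
rewrite -ltr_ndivlMl // (@le_lt_trans _ _ ((ray_lncoef t)^-1 * - ray_coef t - 1)) //.
  by near: r; exact: near_ln_le.
by rewrite ltrBlDr ltrDl.
Unshelve. all: by end_near. Qed.

Lemma u1_ray_lt0 t : 0 < t <= 2 * pi -> 0 < ray_lncoef t ->
  \forall r \near 0^'+, u1 (polar r t) < 0.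
Proof.
move=> t0 B0; near=> r; have r0 : 0 < r by near: r; exact: nbhs_right_gt.
rewrite u1_ray // pmulr_rlt0 ?exprn_gt0 // -ltrBrDl sub0r.
rewrite -ltr_pdivlMl // (@le_lt_trans _ _ ((ray_lncoef t)^-1 * - ray_coef t - 1)) //.
  by near: r; exact: near_ln_le.
by rewrite ltrBlDr ltrDl.
Unshelve. all: by end_near. Qed.

(** The sign of [sin (2 t)] decides, except on the rays [t = pi] and
    [t = 2 pi], where [u1] is [0] and [- r^2 / 4]. *)
Lemma u1_sign t : 0 < t <= 2 * pi -> t != pi / 2 -> ~~ (pi < t <= 3 * pi / 2) ->
  \forall r \near 0^'+, (t <= pi / 2) = (0 < u1 (polar r t)).
Proof.
have pi0 := @pi_gt0 R; have pi40 : 0 < (4 * pi)^-1 :> R by rewrite invr_gt0 mulr_gt0.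
move=> t0; have /andP[t1 t2] := t0; rewrite neq_lt => /orP[tpi _|tpi tn].
  have s0 : 0 < sin (2 * t) by apply: sin_gt0_pi; lra.
  have B0 : ray_lncoef t < 0 by rewrite /ray_lncoef mulNr oppr_lt0 mulr_gt0.
  by apply: filterS (u1_ray_gt0 t0 B0) => r ->; rewrite (ltW tpi).
have -> : (t <= pi / 2) = false by apply/negbTE; rewrite -ltNge.
suff : \forall r \near 0^'+, u1 (polar r t) <= 0.
  by apply: filterS => r ur; apply/esym/negbTE; rewrite -leNgt.
have pos : sin (2 * t) < 0 -> \forall r \near 0^'+, u1 (polar r t) <= 0.
  move=> s0; have B0 : 0 < ray_lncoef t by rewrite /ray_lncoef mulr_gt0 // oppr_gt0.
  by apply: filterS (u1_ray_lt0 t0 B0) => r; exact: ltW.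
have tF : (t <= pi / 2) = false by apply/negbTE; rewrite -ltNge.
have [tp|tp|tp] := ltgtP t pi.
- apply: pos; have -> : 2 * t = (2 * t - pi) + pi by ring.
  by rewrite sinDpi oppr_lt0; apply: sin_gt0_pi; lra.
- have t3 : 3 * pi / 2 < t by move: tn; rewrite tp /= -ltNge.
  have [tp2|tp2] := ltP t (2 * pi).
    apply: pos; have -> : 2 * t = (2 * t - 3 * pi) + pi *+ 2 + pi by rewrite mulr2n; ring.
    by rewrite sinDpi sinD2pi oppr_lt0; apply: sin_gt0_pi; lra.
  have tE : t = 2 * pi by apply/eqP; rewrite eq_le t2 tp2.
  near=> r; have r0 : 0 < r by near: r; exact: nbhs_right_gt.
  rewrite u1_ray // /ray_coef /ray_lncoef tF tE.
  have -> : 2 * (2 * pi) = 0 + pi *+ 2 + pi *+ 2 :> R by rewrite mulr2n; ring.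
  rewrite sinD2pi sinD2pi cosD2pi cosD2pi sin0 cos0 oppr0 !mul0r addr0 mulr1.
  rewrite pmulr_rle0 ?exprn_gt0 // div1r.
  have -> : 2 * pi / (4 * pi) = 2^-1 :> R.
    by move: (pi : R) pi0 => P P0; field; rewrite gt_eqF.
  by lra.
- near=> r; have r0 : 0 < r by near: r; exact: nbhs_right_gt.
  rewrite u1_ray // /ray_coef /ray_lncoef tF tp.
  have -> : 2 * pi = pi *+ 2 :> R by rewrite mulr_natl.
  rewrite sin2pi cos2pi oppr0 !mul0r addr0 mulr1.
  have -> : pi / (4 * pi) = 1 / 4 :> R.
    by move: (pi : R) pi0 => P P0; field; rewrite gt_eqF.
  by rewrite subrr mulr0.
Unshelve. all: by end_near. Qed.

Lemma derive_ray_poly r a b : 0 < r ->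
  is_derive r 1 (fun r => r ^+ 2 * (a + b * ln r)) (r * (2 * a + b + 2 * b * ln r)).
Proof.
move=> r0; have dl := is_derive1_ln r0.
apply: is_derive_eq; rewrite /GRing.scale /=; field.
by rewrite gt_eqF.
Qed.

Lemma derive_ray_poly1 r a b : 0 < r ->
  is_derive r 1 (fun r => r * (a + b * ln r)) (a + b + b * ln r).
Proof.
move=> r0; have dl := is_derive1_ln r0.
apply: is_derive_eq; rewrite /GRing.scale /=; field.
by rewrite gt_eqF.
Qed.

Lemma near_pos r : 0 < r -> \forall s \near r, 0 < s.
Proof. by move=> r0; exact: lt_nbhsr. Qed.

Lemma u1_ray_derive2 r t : 0 < r -> 0 < t <= 2 * pi ->
  let f := fun r : R => u1 (polar r t) in
  [/\ derivable f r 1, derivable (derive1 f) r 1 &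
      derive1n 2 f r = 2 * ray_coef t + 3 * ray_lncoef t + 2 * ray_lncoef t * ln r].
Proof.
move=> r0 t0 f; set a := ray_coef t; set b := ray_lncoef t.
have fd s : 0 < s -> is_derive s 1 f (s * (2 * a + b + 2 * b * ln s)).
  move=> s0; apply: near_eq_is_derive (derive_ray_poly a b s0).
  by apply: filterS (near_pos s0) => q q0; rewrite /f u1_ray.
have f1 : is_derive r 1 (derive1 f) (2 * a + 3 * b + 2 * b * ln r).
  have D := derive_ray_poly1 (2 * a + b) (2 * b) r0.
  have -> : 2 * a + 3 * b + 2 * b * ln r = 2 * a + b + 2 * b + 2 * b * ln r by ring.
  apply: near_eq_is_derive D.
  by apply: filterS (near_pos r0) => q q0; rewrite derive1E (@derive_val _ _ _ _ _ _ _ (fd q q0)).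
split.
- exact: (@ex_derive _ _ _ _ _ _ _ (fd r r0)).
- exact: (@ex_derive _ _ _ _ _ _ _ f1).
- by rewrite derive1nS derive1n1 derive1E; exact: (@derive_val _ _ _ _ _ _ _ f1).
Qed.

(** Applied with [L = ln r]: near the origin the logarithmic term of the second
    radial derivative dominates the constant one. *)
Lemma norm_add_dominated (b d L : R) : `|d| <= `|b| * `|L| ->
  `|b| * `|L| <= `|d + 2 * b * L| <= 3 * `|b| * `|L|.
Proof.
have -> : `|b| * `|L| = `|b * L| by rewrite normrM.
have -> : 3 * `|b| * `|L| = 3 * `|b * L| by rewrite normrM mulrA.
rewrite -mulrA => dL; have := lerB_normD (2 * (b * L)) d.
have := ler_normD d (2 * (b * L)).
rewrite (addrC (2 * _)) [in `|2 * _|]normrM (ger0_norm (_ : 0 <= 2)) // => ? ?.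
by apply/andP; split; lra.
Qed.

Lemma u1_ray_blowup t : 0 < t <= 2 * pi -> sin (2 * t) != 0 ->
  let f := fun r : R => u1 (polar r t) in
  (exists c C : R, [/\ 0 < c, 0 < C &
     \forall r \near 0^'+,
       [/\ derivable f r 1, derivable (derive1 f) r 1,
           c * `|ln r| <= `|derive1n 2 f r| & `|derive1n 2 f r| <= C * `|ln r|]]) /\
  `|derive1n 2 f r| @[r --> 0^'+] --> +oo.
Proof.
move=> t0 s0 f; have pi0 := @pi_gt0 R.
pose b := ray_lncoef t; pose d := 2 * ray_coef t + 3 * b.
have b0 : 0 < `|b|.
  by rewrite normr_gt0 /b /ray_lncoef mulf_neq0 ?oppr_eq0 // invr_eq0 mulf_neq0 // gt_eqF.
have H : \forall r \near 0^'+, [/\ derivable f r 1, derivable (derive1 f) r 1,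
    `|b| * `|ln r| <= `|derive1n 2 f r| & `|derive1n 2 f r| <= (3 * `|b|) * `|ln r|].
  near=> r; have r0 : 0 < r by near: r; exact: nbhs_right_gt.
  have [f1 f2 ->] := u1_ray_derive2 r0 t0.
  have : `|d| <= `|b| * `|ln r|.
    rewrite mulrC -ler_pdivrMr //.
    have : ln r <= - (`|d| / `|b|) by near: r; exact: near_ln_le.
    by rewrite lerNr => /le_trans; apply; rewrite -normrN ler_norm.
  by move=> /norm_add_dominated/andP[].
split; first by exists `|b|, (3 * `|b|); split=> //; rewrite mulr_gt0.
apply/cvgryPge => M; near=> r.
have [_ _ lb _] : [/\ derivable f r 1, derivable (derive1 f) r 1,
    `|b| * `|ln r| <= `|derive1n 2 f r| & `|derive1n 2 f r| <= (3 * `|b|) * `|ln r|].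
  by near: r.
apply: le_trans lb; rewrite mulrC -ler_pdivrMr //.
have : ln r <= - (M / `|b|) by near: r; exact: near_ln_le.
by rewrite lerNr => /le_trans; apply; rewrite -normrN ler_norm.
Unshelve. all: by end_near. Qed.

End radial.

(** * Null sets and contact sets *)

Section plane_null_sets.
Context {R : realType}.
Implicit Types (x y : R * R) (A E : set (R * R)) (f g : R * R -> R).
Local Notation mu := (@plane_measure R).

#[global] Instance plane_ae_filter : Filter (nbhs (almost_everywhere mu)).
Proof. exact: (ae_filter_ringOfSetsType (@lebesgue_measure R \x @lebesgue_measure R)%E). Qed.

Definition ratbox (i : (rat * rat) * (rat * rat)) : set (R * R) :=
  [set` `]ratr i.1.1, ratr i.1.2[] `*` [set` `]ratr i.2.1, ratr i.2.2[].

(** Open sets are countable unions of boxes with rational corners. *)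
Lemma open_measurable_plane A : open A -> measurable A.
Proof.
rewrite openE => Ao.
have -> : A = \bigcup_i (if `[< ratbox i `<=` A >] then ratbox i else set0).
  apply/seteqP; split => [x /Ao/nbhs_ballP[e /= e0 eA]|x [i _]]; last first.
    by case: ifPn => // /asboolP; exact.
  have ratlr (t : R) : exists p q : rat, [/\ t - e < ratr p < t & t < ratr q < t + e].
    have [p] := @rat_in_itvoo R (t - e) t ltac:(lra).
    have [q] := @rat_in_itvoo R t (t + e) ltac:(lra).
    by rewrite !in_itv /= => qt pt; exists p, q.
  have [a [b [xa xb]]] := ratlr x.1; have [c [d [xc xd]]] := ratlr x.2.
  exists ((a, b), (c, d)) => //; rewrite asboolT; last first.
    move=> [y1 y2] [] /=; rewrite !in_itv /= => y1ab y2cd; apply: eA; split;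
    rewrite /ball /= ltr_norml; apply/andP; split; lra.
  by split; rewrite /= in_itv /=; apply/andP; split; lra.
apply: countable_bigcupT_measurable => // i; case: ifPn => // _.
by apply: measurableX; exact: measurable_itv.
Qed.

Lemma closed_measurable_plane A : closed A -> measurable A.
Proof.
move=> Ac; rewrite -(setCK A); apply: measurableC; apply: open_measurable_plane.
exact: closed_openC.
Qed.

Lemma null_of_horizontal A : measurable A -> (forall y : R, countable (ysection A y)) ->
  mu A = 0%E.
Proof.
move=> mA Ay; rewrite /plane_measure.
have -> : (@lebesgue_measure R \x @lebesgue_measure R)%E A =
    (@lebesgue_measure R \x^ @lebesgue_measure R)%E A.
  by apply: product_measure_unique => //= ? ? ? ?; rewrite product_measure2E.
rewrite /= /product_measure2 integral0_eq // => y _ /=.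
exact: countable_lebesgue_measure0.
Qed.

Lemma null_of_vertical A : measurable A -> (forall x : R, countable (xsection A x)) ->
  mu A = 0%E.
Proof.
move=> mA Ax; rewrite /plane_measure /product_measure1 integral0_eq // => x _ /=.
exact: countable_lebesgue_measure0.
Qed.

Lemma separated_countable (S : set R) (d : R) : 0 < d ->
  (forall s t, S s -> S t -> s < t -> d <= t - s) -> countable S.
Proof.
move=> d0 Sd; apply/countable_injP.
(* Two points with the same integer part of [t / d] are closer than [d]. *)
exists (fun t => pickle (Num.floor (t / d))) => s t; rewrite !inE => Ss St.
move=> /(pcan_inj pickleK) fE.
have := floor_itv (s / d); have := floor_itv (t / d); rewrite fE.
set m := Num.floor _; rewrite intrD => /andP[t1 t2] /andP[s1 s2].
have close u v : u / d < m%:~R + 1 -> m%:~R <= v / d -> u - v < d.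
  move=> u2 v1; have : (u - v) / d < 1 by rewrite mulrBl; lra.
  by rewrite ltr_pdivrMr // mul1r.
have [st|ts|//] := ltgtP s t.
  by have := Sd _ _ Ss St st; rewrite leNgt close.
by have := Sd _ _ St Ss ts; rewrite leNgt close.
Qed.

Lemma derive_gt0_near f x v : derivable f x v -> f x = 0 -> 0 < 'D_v f x ->
  exists2 e : R, 0 < e & forall s, s != 0 -> `|s| < e ->
    'D_v f x / 2 < s^-1 * f (x + s *: v).
Proof.
move=> df fx D0; have D2 : 0 < 'D_v f x / 2 by rewrite divr_gt0.
have lim_df : h^-1 *: (f (h *: v + x) - f x) @[h --> 0^'] --> 'D_v f x := df.
have /cvgrPdist_lt /(_ _ D2) := lim_df.
rewrite near_withinE => /nbhs_ballP[e /= e0 eP]; exists e => // s s0 se.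
have : `|'D_v f x - s^-1 * f (x + s *: v)| < 'D_v f x / 2.
  have := eP s; rewrite /ball /= sub0r normrN => /(_ se s0).
  by rewrite fx subr0 (addrC x).
by rewrite ltr_distlC => /andP[+ _]; apply: le_lt_trans; lra.
Qed.

(** Zeros of [g] after which [g] grows at least at rate [1 / (k + 1)] in the
    direction [v], for a distance [1 / (n + 1)].  For continuous [g] these sets
    are closed, hence measurable. *)
Definition rising g (v : R * R) (n k : nat) : set (R * R) :=
  [set x | g x = 0] `&` \bigcap_(s in [set s | 0 < s < n.+1%:R^-1])
    [set x | s / k.+1%:R <= g (x + s *: v)].

Lemma closed_rising g v n k : continuous g -> closed (rising g v n k).
Proof.
move=> gc; apply: closedI.
  exact: (continuous_closedP _).1 gc [set 0] (@closed_eq _ _).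
apply: closed_bigI => s _.
have gs : continuous (fun x => g (x + s *: v)).
  move=> x; apply: (@continuous_comp _ _ _ (fun x => x + s *: v) g); last exact: gc.
  by apply: (@cvgD _ _ _ _ _ id (fun=> s *: v)); [exact: cvg_id | exact: cvg_cst].
exact: (continuous_closedP _).1 gs [set t | s / k.+1%:R <= t] (@closed_ge _ _).
Qed.

(** [g] is positive just after a point of the set, so the next zero is at least
    [1 / (n + 1)] away. *)
Lemma rising_separated g v n k x s : 0 < s -> rising g v n k x ->
  rising g v n k (x + s *: v) -> n.+1%:R^-1 <= s.
Proof.
move=> s0 [_ xs] [gs _]; rewrite leNgt; apply/negP => sn.
have := xs s; rewrite /= s0 sn => /(_ isT); rewrite gs leNgt => /negP; apply.
by rewrite divr_gt0.
Qed.

Lemma rising_e1_null g n k : continuous g -> mu (rising g e1 n k) = 0%E.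
Proof.
move=> gc; apply: null_of_horizontal.
  by apply: closed_measurable_plane; exact: closed_rising.
move=> y; apply: (@separated_countable _ n.+1%:R^-1) => // s t.
move=> /ysectionP As /ysectionP At st.
apply: (@rising_separated g e1 n k (s, y)) => //; first by rewrite subr_gt0.
have -> // : (s, y) + (t - s) *: e1 = (t, y).
by congr (_, _); rewrite /e1 /e2 /GRing.scale /= /GRing.scale /=; ring.
Qed.

Lemma rising_e2_null g n k : continuous g -> mu (rising g e2 n k) = 0%E.
Proof.
move=> gc; apply: null_of_vertical.
  by apply: closed_measurable_plane; exact: closed_rising.
move=> y; apply: (@separated_countable _ n.+1%:R^-1) => // s t.
move=> /xsectionP As /xsectionP At st.
apply: (@rising_separated g e2 n k (y, s)) => //; first by rewrite subr_gt0.
have -> // : (y, s) + (t - s) *: e2 = (y, t).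
by congr (_, _); rewrite /e1 /e2 /GRing.scale /= /GRing.scale /=; ring.
Qed.

Lemma risingP g x v : derivable g x v -> g x = 0 -> 0 < 'D_v g x ->
  exists n k, rising g v n k x.
Proof.
move=> dg gx D0; have [e e0 eP] := derive_gt0_near dg gx D0.
have small (c : R) : 0 < c -> exists n : nat, n.+1%:R^-1 < c.
  move=> c0; have [n _ nP] := near_infty_natSinv_lt (PosNum c0).
  by exists n; exact: (nP n (leqnn n)).
have [n ne] := small e e0; have [k kD] := small ('D_v g x / 2) ltac:(lra).
exists n, k; split=> // s /= /andP[s0 sn].
have := eP s; rewrite gt_eqF // gtr0_norm // => /(_ isT (lt_trans sn ne)) sD.
have := lt_trans kD sD; rewrite ltr_pdivlMl // => /ltW.
by rewrite mulrC.
Qed.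

(** Zeros with positive derivative lie in some set [rising g], those with
    negative derivative in some set [rising (- g)]. *)
Lemma derive_zero_ae_of g v : continuous g ->
  (forall f n k, continuous f -> mu (rising f v n k) = 0%E) ->
  {ae mu, forall x, g x = 0 -> derivable g x v -> 'D_v g x = 0}.
Proof.
move=> gc null; have Ngc : continuous (fun x => - g x) by move=> x; exact/continuousN/gc.
pose N f : set (R * R) := \bigcup_n \bigcup_k rising f v n k.
have N0 f : continuous f -> mu.-negligible (N f).
  move=> fc; apply: negligible_bigcup => n; apply: negligible_bigcup => k.
  exists (rising f v n k); split=> //; last exact: null.
  by apply: closed_measurable_plane; exact: closed_rising.
apply: negligibleS (negligibleU (N0 g gc) (N0 _ Ngc)) => x /= /not_implyP[gx /not_implyP[dg /eqP]].
rewrite neq_lt => /orP[D0|D0]; [right|left]; last first.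
  by have [n [k nk]] := risingP dg gx D0; exists n => //; exists k.
have dN : derivable (fun x => - g x) x v by exact: derivableN.
have DN : 0 < 'D_v (fun x => - g x) x by rewrite deriveN // oppr_gt0.
have [|n [k nk]] := risingP dN _ DN; first by rewrite gx oppr0.
by exists n => //; exists k.
Qed.

Lemma derive_zero_ae g : continuous g ->
  {ae mu, forall x, g x = 0 ->
     (derivable g x e1 -> 'D_e1 g x = 0) /\ (derivable g x e2 -> 'D_e2 g x = 0)}.
Proof.
move=> gc.
apply: filterS2 (derive_zero_ae_of gc rising_e1_null) (derive_zero_ae_of gc rising_e2_null).
by move=> x h1 h2 gx; split; [exact: h1 | exact: h2].
Qed.

(** A nonzero derivative would give [f] a negative value on one side of [x]. *)
Lemma derive_at_min f x v : (forall y, 0 <= f y) -> f x = 0 -> derivable f x v ->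
  'D_v f x = 0.
Proof.
move=> f0 fx df.
have half (w : R * R) : derivable f x w -> 'D_w f x <= 0.
  move=> dw; rewrite leNgt; apply/negP => D0.
  have [e e0 eP] := derive_gt0_near dw fx D0.
  have := eP (- (e / 2)); rewrite oppr_eq0 gt_eqF ?divr_gt0 // normrN gtr0_norm ?divr_gt0 //.
  move=> /(_ isT ltac:(lra)); rewrite ltNge => /negP; apply.
  rewrite (@le_trans _ _ 0) //; last by rewrite divr_ge0 // ltW.
  by rewrite mulr_le0_ge0 // invr_le0 oppr_le0 divr_ge0 // ltW.
have half' (w : R * R) : derivable f x w -> 0 <= 'D_w f x.
  move=> dw; rewrite leNgt; apply/negP => D0.
  have dN : derivable (fun y => - f y) x w by exact: derivableN.
  have DN : 0 < 'D_w (fun y => - f y) x by rewrite deriveN // oppr_gt0.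
  have fN : - f x = 0 by rewrite fx oppr0.
  have [e e0 eP] := derive_gt0_near dN fN DN.
  have := eP (e / 2); rewrite gt_eqF ?divr_gt0 // gtr0_norm ?divr_gt0 //.
  move=> /(_ isT ltac:(lra)); rewrite ltNge => /negP; apply.
  rewrite (@le_trans _ _ 0) //; last by rewrite divr_ge0 // ltW.
  by rewrite mulr_ge0_le0 ?oppr_le0 // invr_ge0 divr_ge0 // ltW.
by apply/eqP; rewrite eq_le half // half'.
Qed.

(** At a zero, which is a minimum, the gradient vanishes; [derive_zero_ae] is then
    applied to each of its components. *)
Lemma contact_laplacian_ae f : C1 f -> (forall y, 0 <= f y) ->
  {ae mu, forall x, f x = 0 -> forall l, has_laplacian f x l -> l = 0}.
Proof.
move=> [df f1 f2] f0.
apply: filterS2 (derive_zero_ae f1) (derive_zero_ae f2) => x h1 h2 fx l [_ d1 d2 <-].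
have g1 : 'D_e1 f x = 0 by apply: derive_at_min => //; exact: diff_derivable.
have g2 : 'D_e2 f x = 0 by apply: derive_at_min => //; exact: diff_derivable.
rewrite (h1 g1).1 ?(h2 g2).2 ?addr0 //; exact: diff_derivable.
Qed.

Lemma off_axes_ae : {ae mu, forall x, x.1 != 0 /\ x.2 != 0}.
Proof.
have c1 : continuous (fst : R * R -> R) by move=> x; exact: cvg_fst.
have c2 : continuous (snd : R * R -> R) by move=> x; exact: cvg_snd.
have m1 : measurable [set x : R * R | x.1 = 0].
  apply: closed_measurable_plane.
  exact: (continuous_closedP _).1 c1 [set 0] (@closed_eq _ _).
have m2 : measurable [set x : R * R | x.2 = 0].
  apply: closed_measurable_plane.
  exact: (continuous_closedP _).1 c2 [set 0] (@closed_eq _ _).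
have n1 : mu.-negligible [set x : R * R | x.1 = 0].
  exists [set x : R * R | x.1 = 0]; split=> //; apply: null_of_horizontal => // y.
  apply: (@sub_countable _ _ _ [set (0 : R)]); last exact: countable1.
  by apply: subset_card_le => t /ysectionP.
have n2 : mu.-negligible [set x : R * R | x.2 = 0].
  exists [set x : R * R | x.2 = 0]; split=> //; apply: null_of_vertical => // y.
  apply: (@sub_countable _ _ _ [set (0 : R)]); last exact: countable1.
  by apply: subset_card_le => t /xsectionP.
apply: negligibleS (negligibleU n1 n2) => x /= /not_andP[] /negP; rewrite negbK => /eqP.
  by left.
by right.
Qed.

End plane_null_sets.

(** * Solutions of the system and of the obstacle problem *)

Section obstacle.
Context {R : realType}.
Implicit Types (x y : R * R).

Lemma phiE x : phi x = 4^-1 * x.1 ^+ 2 + 4^-1 * x.2 ^+ 2.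
Proof. by rewrite /phi enorm_sqr; field. Qed.

Lemma phi_gt0 x : x != 0 -> 0 < phi x.
Proof. by move=> x0; rewrite /phi divr_gt0 // exprn_gt0 // enorm_gt0. Qed.

Lemma phi_laplacian x : has_laplacian phi x 1.
Proof.
have := has_laplacian_quadratic 4^-1 4^-1 x.
rewrite (_ : 2 * 4^-1 + 2 * 4^-1 = 1 :> R); last by field.
by apply: near_laplacian; near=> y; rewrite phiE.
Unshelve. all: by end_near. Qed.

Lemma phi_C1 : C1 (@phi R).
Proof.
apply: (@C1I _ _ (fun x => 2^-1 * x.1) (fun x => 2^-1 * x.2)).
- move=> x; have G := gradD (gradZ 4^-1 (gradM (grad_fst x) (grad_fst x)))
    (gradZ 4^-1 (gradM (grad_snd x) (grad_snd x))).
  by apply: (eq_grad G) => [y||] /=; rewrite ?phiE; field.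
- exact/lip_on_continuous/lip_onZ/lip_on_fst.
- exact/lip_on_continuous/lip_onZ/lip_on_snd.
Qed.

Lemma zero_loop_phi : zero_loop_set (@phi R) = [set (0 : R * R)].
Proof.
apply/seteqP; split => x /=; rewrite /zero_loop_set /=.
  have [->//|x0] := eqVneq x 0.
  by move=> /eqP; rewrite gt_eqF // addr_gt0 // phi_gt0.
by move=> ->; rewrite phiE /= expr0n /= mulr0 !addr0.
Qed.

Section difference.
Context (v1 v2 : R * R -> R) (v12 : solves_system (@phi R) v1 v2).
Let U x := v1 x - v2 x.

(** The two contact clauses come from [contact_laplacian_ae] applied to [U + phi]
    and [phi - U], since [phi] has Laplacian 1.  At the origin, where the
    obstacles touch, both clauses apply and contradict each other, so the origin
    belongs to the exceptional null set. *)
Let phases : {ae @plane_measure R, forall x, exists l1 l2,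
  [/\ has_laplacian v1 x l1, has_laplacian v2 x l2 &
   [/\ U x = - phi x -> l1 - l2 = -1, U x = phi x -> l1 - l2 = 1,
       - phi x < U x -> l1 = 0 & U x < phi x -> l2 = 0]]}.
Proof.
case: v12 => [[c1 c2] obst lap off1 off2].
have cU : C1 U by exact: C1B.
have ae1 := contact_laplacian_ae (C1D cU phi_C1) (fun y => (obst y).1).
have ob2 y : 0 <= phi y - U y.
  by have := (obst y).2; rewrite /U; lra.
have ae2 := contact_laplacian_ae (C1B phi_C1 cU) ob2.
apply: filterS3 lap ae1 ae2 => x [[l1 L1 _] [l2 L2 _]] h1 h2.
exists l1, l2; split=> //.
have LU : has_laplacian U x (l1 - l2) := has_laplacianB L1 L2.
have P := phi_laplacian x.
split.
- move=> Ux; have e0 : U x + phi x = 0 by rewrite Ux addNr.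
  by have := h1 e0 _ (has_laplacianD LU P); lra.
- move=> Ux; have e0 : phi x - U x = 0 by rewrite Ux subrr.
  by have := h2 e0 _ (has_laplacianB P LU); lra.
- move=> Ux; have p0 : 0 < v1 x - v2 x + phi x by rewrite /U in Ux; lra.
  exact: has_laplacian_uniq L1 (nbhs_singleton (off1 x p0)).
- move=> Ux; have p0 : 0 < v2 x - v1 x + phi x by rewrite /U in Ux; lra.
  exact: has_laplacian_uniq L2 (nbhs_singleton (off2 x p0)).
Qed.

Lemma difference_double_obstacle : solves_double_obstacle (@phi R) U.
Proof.
case: (v12) => [[c1 c2] obst _ _ _]; split.
- exact: C1B.
- by move=> x; have [] := obst x; rewrite /U => ? ?; apply/andP; split; lra.
apply: filterS phases => x [l1 [l2 [L1 L2 [hm hp h1 h2]]]].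
exists (l1 - l2); split; first exact: has_laplacianB.
- by move=> /hm ->; rewrite opprK.
- by move=> /hp ->.
- by move=> /andP[/h1 -> /h2 ->]; rewrite subrr oppr0.
Qed.

Lemma difference_laplacians : {ae @plane_measure R, forall x, exists l,
  [/\ has_laplacian U x l,
      (exists2 l1, has_laplacian v1 x l1 & - l1 = Num.max (- l) 0) &
      (exists2 l2, has_laplacian v2 x l2 & - l2 = Num.max l 0)]}.
Proof.
case: (v12) => [_ obst _ _ _].
apply: filterS phases => x [l1 [l2 [L1 L2 [hm hp h1 h2]]]].
exists (l1 - l2); have LU := has_laplacianB L1 L2.
have [q1 q2] := obst x.
have Um : - phi x <= U x by rewrite /U; lra.
have Up : U x <= phi x by rewrite /U; lra.
suff E12 : - l1 = Num.max (- (l1 - l2)) 0 /\ - l2 = Num.max (l1 - l2) 0.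
  by case: E12 => E1 E2; split=> //; [exists l1 | exists l2].
move: Um; rewrite le_eqVlt => /orP[/eqP Um|Um].
  move: Up; rewrite le_eqVlt => /orP[/eqP Up|Up].
    by have := hm (esym Um); rewrite (hp Up) => E; exfalso; lra.
  have l20 := h2 Up; have l1E : l1 = -1 by have := hm (esym Um); rewrite l20 subr0.
  rewrite l20 l1E subr0 opprK oppr0.
  by split; [rewrite max_l // ler01 | rewrite max_r // lerN10].
have l10 := h1 Um; move: Up; rewrite le_eqVlt => /orP[/eqP Up|Up].
  have l2E : l2 = -1 by have := hp Up; rewrite l10; lra.
  rewrite l10 l2E sub0r !opprK oppr0.
  by split; [rewrite max_r // lerN10 | rewrite max_l // ler01].
by rewrite l10 (h2 Up) subrr oppr0 maxxx.
Qed.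

End difference.

Lemma w_phi x : - phi x <= w x <= phi x.
Proof.
rewrite wE phiE; have n1 := sqr_ge0 x.1; have n2 := sqr_ge0 x.2.
have b1 : `|x.1 * `|x.1| | <= x.1 ^+ 2 by rewrite normrM normr_id -expr2 -sqr_normE.
have b2 : `|x.2 * `|x.2| | <= x.2 ^+ 2 by rewrite normrM normr_id -expr2 -sqr_normE.
move: b1 b2; rewrite !ler_norml => /andP[? ?] /andP[? ?].
by apply/andP; split; lra.
Qed.

Lemma w_off_Q1 x : 0 < w x + phi x -> (x.1 < 0) || (x.2 < 0).
Proof.
rewrite wE phiE; have [//|x1 /=] := ltP x.1 0; have [//|x2 /=] := ltP x.2 0.
by rewrite !ger0_norm //; lra.
Qed.

Lemma w_off_Q3 x : 0 < phi x - w x -> ((- x).1 < 0) || ((- x).2 < 0).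
Proof. by move=> xw; apply: w_off_Q1; rewrite wN /phi enormN addrC. Qed.

Lemma w_double_obstacle : solves_double_obstacle (@phi R) (@w R).
Proof.
split; [exact: w_C1 | exact: w_phi |].
apply: filterS off_axes_ae => x [x1 x2].
exists (- (Num.sg x.1 + Num.sg x.2) / 2); split; first exact: w_laplacian.
- rewrite wE phiE; move: x1 x2; rewrite !neq_lt => /orP[] x1 /orP[] x2;
  rewrite ?(ltr0_norm x1) ?(ltr0_norm x2) ?(gtr0_norm x1) ?(gtr0_norm x2)
    ?(ltr0_sg x1) ?(ltr0_sg x2) ?(gtr0_sg x1) ?(gtr0_sg x2);
  nra.
- rewrite wE phiE; move: x1 x2; rewrite !neq_lt => /orP[] x1 /orP[] x2;
  rewrite ?(ltr0_norm x1) ?(ltr0_norm x2) ?(gtr0_norm x1) ?(gtr0_norm x2)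
    ?(ltr0_sg x1) ?(ltr0_sg x2) ?(gtr0_sg x1) ?(gtr0_sg x2);
  nra.
- rewrite wE phiE; move: x1 x2; rewrite !neq_lt => /orP[] x1 /orP[] x2;
  rewrite ?(ltr0_norm x1) ?(ltr0_norm x2) ?(gtr0_norm x1) ?(gtr0_norm x2)
    ?(ltr0_sg x1) ?(ltr0_sg x2) ?(gtr0_sg x1) ?(gtr0_sg x2) => /andP[]; nra.
Qed.

Lemma u12_solves : solves_system (@phi R) (@u1 R) (@u2 R).
Proof.
have uw x : u1 x - u2 x = w x by rewrite u2E; lra.
split.
- by split; [exact: u1_C1 | exact: u2_C1].
- by move=> x; have /andP[? ?] := w_phi x; rewrite -[u2 x - u1 x]opprB uw; split; lra.
- have lapN y : y.1 != 0 -> y.2 != 0 -> exists2 l, has_laplacian (@u1 R) y l & 0 <= - l.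
    move=> y1 y2; have [y12|] := boolP ((y.1 < 0) || (y.2 < 0)).
      by exists 0; [exact: u1_lap_off_Q1 | rewrite oppr0].
    rewrite negb_or -!leNgt => /andP[y1' y2'].
    by exists (-1); [apply: u1_lap_Q1; rewrite lt_def ?y1 ?y2 | rewrite opprK ler01].
  apply: filterS off_axes_ae => x [x1 x2]; split; first exact: lapN.
  have [||l L l0] := lapN (- x); rewrite ?oppr_eq0 //.
  by exists l; [exact: u2_laplacian L | exact: l0].
- move=> x; rewrite uw => /w_off_Q1/near_off_Q1; apply: filterS => y.
  exact: u1_lap_off_Q1.
- move=> x; rewrite -[u2 x - u1 x]opprB uw addrC => /w_off_Q3/near_off_Q1 nx.
  have dN : differentiable (fun y : R * R => - y) x.
    by case: (is_diffN (is_diff_id x)).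
  have nN : \forall y \near x, ((- y).1 < 0) || ((- y).2 < 0).
    exact: (differentiable_continuous dN nx).
  apply: filterS nN => y y12.
  by apply: u2_laplacian; exact: u1_lap_off_Q1.
Qed.

End obstacle.

Theorem mainTheorem3 (R : realType) :
  (* the zero loop set *)
  zero_loop_set (@phi R) = [set (0 : R * R)] /\
  isolated (zero_loop_set (@phi R)) 0 /\
  (* the difference of the components of any solution *)
  (forall v1 v2 : R * R -> R, solves_system (@phi R) v1 v2 ->
     let U := fun x => v1 x - v2 x in
     solves_double_obstacle (@phi R) U /\
     {ae @plane_measure R, forall x, exists l,
        [/\ has_laplacian U x l,
            (exists2 l1, has_laplacian v1 x l1 & - l1 = Num.max (- l) 0) &
            (exists2 l2, has_laplacian v2 x l2 & - l2 = Num.max l 0)]}) /\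
  (* the function w *)
  C1holder setT 1 (@w R) /\
  solves_double_obstacle (@phi R) (@w R) /\
  (* u1 and u2 in polar coordinates *)
  (forall r t : R, 0 < r -> 0 < t <= 2 * pi ->
     u1 (polar r t) = u1_pol r t /\ u2 (polar r t) = u2_pol r t) /\
  (forall x : R * R, u2 x = u1 x - w x) /\
  (* the harmonic function h on sectors that avoid the cut *)
  (forall r t : R, 0 < r -> 0 < t < 2 * pi ->
     has_laplacian (@h R) (polar r t) 0) /\
  (forall a b : R, 0 <= a -> a < b -> b <= 2 * pi -> b - a < 2 * pi ->
     (forall g : R, 0 < g < 1 ->
        C1holder (@unit_ball R `&` sector a b) g (@h R)) /\
     (forall V : set (R * R), open V -> V 0 ->
        ~ C1holder (V `&` sector a b) 1 (@h R))) /\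
  (* regularity of u1 *)
  (forall g : R, 0 < g < 1 -> C1holder (@unit_ball R) g (@u1 R)) /\
  (forall t : R, 0 < t <= 2 * pi -> sin (2 * t) != 0 ->
     let f := fun r : R => u1 (polar r t) in
     (exists c C : R, [/\ 0 < c, 0 < C &
        \forall r \near 0^'+,
          [/\ derivable f r 1, derivable (derive1 f) r 1,
              c * `|ln r| <= `|derive1n 2 f r| & `|derive1n 2 f r| <= C * `|ln r|]]) /\
     `|derive1n 2 f r| @[r --> 0^'+] --> +oo) /\
  ~ C11_near (@u1 R) 0 /\
  (* the Laplacian and the sign of u1 *)
  (forall r t : R, 0 < r -> 0 < t < 2 * pi -> t != pi / 2 ->
     has_laplacian (@u1 R) (polar r t) (- ((t <= pi / 2)%R%:R))) /\
  (forall t : R, 0 < t <= 2 * pi -> t != pi / 2 -> ~~ (pi < t <= 3 * pi / 2) ->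
     \forall r \near 0^'+, (t <= pi / 2) = (0 < u1 (polar r t))) /\
  (* (u1, u2) is a solution that is not C^{1,1} near the origin *)
  ~ C11_near (@u2 R) 0 /\
  solves_system (@phi R) (@u1 R) (@u2 R).
Proof.
split; first exact: zero_loop_phi.
split.
  rewrite zero_loop_phi; split; first by rewrite inE.
  by exists setT; [exact: filterT | rewrite setTI].
split.
  move=> v1 v2 v12; split; first exact: difference_double_obstacle.
  exact: difference_laplacians.
split; first exact: w_C11.
split; first exact: w_double_obstacle.
split.
  by move=> r t r0 t0; rewrite /u1 /u2; have [-> ->] := polarK r0 t0.
split; first exact: u2E.
split.
  move=> r t r0 /andP[t0 t2]; apply: h_harmonic.
  have [nE aE] := polarK r0 (introT andP (conj t0 (ltW t2))).
  by rewrite slitP ?aE // -enorm_eq0 nE gt_eqF.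
split.
  move=> a b a0 ab b2 ba; split; first by move=> g; exact: h_holder.
  by move=> V Vo V0; exact: h_notC11.
split; first exact: u1_holder.
split; first exact: u1_ray_blowup.
split; first exact: u1_notC11.
split; first exact: u1_lap_polar.
split; first exact: u1_sign.
split; first exact: u2_notC11.
exact: u12_solves.
Qed.
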